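(* Let $H$ be a real or complex Hilbert space with $\dim H \ge 3$, and let $\mathbb{F}\in\{\mathbb{R},\mathbb{C}\}$ be its scalar field. Then a map $\phi : [0, I] \to [0, I]$ is an order automorphism if and only if there exists a bijective semilinear bounded operator $T: H\to H$ such that $$ \phi (X) = \phi_T(X) := T \left( X (T^\ast T -I) +I \right)^{-1} X T^\ast $$ for every $X \in [0,I]$. Moreover, if $T, S : H \to H$ are invertible bounded semilinear operators and $\phi_T (X) = \phi_S (X)$ for every $X \in [0,I]$, then $T = cS$ for some $c \in \mathbb{F}$ with $|c| =1$.
   Context: $S(H)$ denotes the set of all bounded self-adjoint linear operators on the Hilbert space $H$, $I$ is the identity operator. An operator $A\in S(H)$ is positive, $A\ge 0$, if $\langle Ax,x\rangle \ge 0$ for every $x\in H$; for $A,B\in S(H)$, $A\le B$ means $B-A\ge 0$. The effect algebra is $[0,I]=\{A\in S(H) : 0\le A\le I\}$. An order automorphism of $[0,I]$ is a bijective map $\phi:[0,I]\to[0,I]$ such that for all $X,Y\in[0,I]$: $X\le Y \iff \phi(X)\le\phi(Y)$. A bijective (equivalently, invertible) bounded semilinear operator $T:H\to H$ is a bijective continuous map that is linear when $H$ is real, and is either linear or conjugate-linear when $H$ is complex. If $H$ is complex and $T$ is bounded conjugate-linear, then $T^\ast:H\to H$ is the unique bounded conjugate-linear operator with $\langle Tx,y\rangle=\overline{\langle x,T^\ast y\rangle}$ for all $x,y\in H$; if $T$ is linear, $T^\ast$ is the usual adjoint. In all cases $T^\ast T$ is a linear operator. *)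

(* Defs.v *)
From HB Require Import structures.
From mathcomp Require Import all_boot all_order all_algebra.
From mathcomp Require Import complex.
From mathcomp Require Import all_classical all_reals all_analysis.

Set Implicit Arguments.
Unset Strict Implicit.
Unset Printing Implicit Defensive.

Import Order.TTheory GRing.Theory Num.Theory.
Import numFieldNormedType.Exports.

Local Open Scope classical_set_scope.
Local Open Scope ring_scope.

(* Real and complex Hilbert spaces are treated uniformly: the scalar field is
   the real field R or the complex field R[i], and the conjugation on the real
   field is the identity. *)
Variant scalar_kind := RealScalars | ComplexScalars.

Definition scalar_field (R : realType) (k : scalar_kind) : numFieldType :=
  match k with RealScalars => R | ComplexScalars => R[i] end.

Definition scalar_conj (R : realType) (k : scalar_kind) :
    scalar_field R k -> scalar_field R k :=
  match k return scalar_field R k -> scalar_field R k with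
  | RealScalars => idfun
  | ComplexScalars => fun z : R[i] => Num.conj z
  end.

Arguments scalar_conj : clear implicits.

(* This compares the possibly infinite dimension of V with a natural number. *)
Definition dim_ge (K : numFieldType) (n : nat) (V : lmodType K) : Prop :=
  exists v : 'I_n -> V, forall c : 'I_n -> K,
    \sum_(i < n) c i *: v i = 0 -> forall i, c i = 0.

Section Operators.
Variables (K : numFieldType) (conj : K -> K).
Variables (H : completeNormedModType K) (dot : {dot H for conj}).
Implicit Types T A B X : H -> H.

Definition bounded_linear T : Prop := linear T /\ continuous T.

Definition conj_linear T : Prop :=
  forall (a : K) (x y : H), T (a *: x + y) = conj a *: T x + T y.

Definition bounded_conj_linear T : Prop := conj_linear T /\ continuous T.

Definition invertible_semilinear T : Prop :=
  bijective T /\ (bounded_linear T \/ bounded_conj_linear T).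

Definition is_linear_adjoint T A : Prop :=
  [/\ bounded_linear T, bounded_linear A &
      forall x y, dot (T x) y = dot x (A y)].

Definition is_conj_linear_adjoint T A : Prop :=
  [/\ bounded_conj_linear T, bounded_conj_linear A &
      forall x y, dot (T x) y = conj (dot x (A y))].

(* The two alternatives never disagree: they coincide when conj is the identity,
   and over the complex field only T = 0 is both linear and conjugate-linear. *)
Definition adjoint T : H -> H :=
  xget (cst 0) [set A | is_linear_adjoint T A \/ is_conj_linear_adjoint T A].

Definition is_inverse A B : Prop :=
  [/\ bounded_linear B, cancel A B & cancel B A].

Definition op_inv A : H -> H := xget (cst 0) [set B | is_inverse A B].

Definition selfadjoint A : Prop := is_linear_adjoint A A.

Definition op_ge0 A : Prop := forall x, 0 <= dot (A x) x.

Definition op_le A B : Prop := op_ge0 (B \- A).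

Definition effects : set (H -> H) :=
  [set A | [/\ selfadjoint A, op_le (cst 0) A & op_le A idfun]].

Definition order_automorphism (phi : effects -> effects) : Prop :=
  bijective phi /\
  forall X Y : effects,
    op_le (\val X) (\val Y) <-> op_le (\val (phi X)) (\val (phi Y)).

Definition phi_denom T X : H -> H :=
  (X \o ((adjoint T \o T) \- idfun)) \+ idfun.

Definition phi_op T X : H -> H :=
  T \o op_inv (phi_denom T X) \o X \o adjoint T.

End Operators.

Arguments invertible_semilinear {K} conj {H} T.

(* Main.v *)
(* An effect X is encoded by the relation {(X x, x - X x)}, that is by the
   positive quadratic form <(X^-1 - I) u, u>, infinite off the range of X^(1/2);
   the order of effects is the reverse order of these forms, and phi_T is the
   substitution of T in the form.  This gives the easy half of the theorem.

   Conversely, let f be an order automorphism.  An effect is of rank one iff it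
   is nonzero and the effects below it form a chain, and a line lies in the span
   of two others iff its projection is below all effects above the other two
   projections, so f acts on lines by a semilinear S (fundamental theorem of
   projective geometry).  Writing E(u, c) for the rank-one effect whose form
   takes the value c at u, f maps E(u, c) to E(S u, g_u(c)).  The parallelogram
   law for the forms of E(a, p) + E(b, q) and of its image, a and b orthogonal,
   reads g_{a+b}(p + q) + g_{a-b}(p + q) = 2 g_a(p) + 2 g_b(q).  Hence g_u is
   multiplication by a constant independent of u, since dim H >= 3, and
   rescaling S gives T with f(E(u, c)) = E(T u, c).  Comparing E(x u, |x|^2 c)
   with E(u, c) shows that the field morphism of T preserves moduli, so it is
   the identity or the conjugation; T is bounded by uniform boundedness applied
   to the image of I/2.  Since an effect is determined by the rank-one effects
   below it, f = phi_T. *)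

(* For invertible X the formula amounts to phi_T(X)^-1 - I = T*^-1 (X^-1 - I) T^-1. A general X has
   no inverse, so its form is reached indirectly: for phi_T through the relation, and for f through
   the dual norm, the supremum over z of 2 Re<u, z> - <A z, z>, which is |u|^2 plus the value of the
   form at u. The order reads it off: E(u, c) <= A iff |u|^2 + c bounds it. The projective theorem
   yields only an algebraic S, with no control of norms or angles. Metric information enters with
   the parallelogram law for dual norms, from which the terms in |S a|^2 and |S b|^2 cancel by the
   ordinary law. Its left side depends on p + q alone, so p and q can be traded between a and b:
   orthogonal vectors have the same g, and g is additive. Linear and conjugate-linear operators are
   treated together through Re<x, y>, for which both kinds of adjoint satisfy the same identity. *)
Require Import Defs.
From HB Require Import structures.
From mathcomp Require Import all_boot all_order all_algebra.
From mathcomp Require Import complex.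
From mathcomp Require Import all_classical all_reals all_analysis.
From mathcomp Require Import ring lra.

Set Implicit Arguments.
Unset Strict Implicit.
Unset Printing Implicit Defensive.

Import Order.TTheory GRing.Theory Num.Theory.
Import numFieldNormedType.Exports.

Local Open Scope classical_set_scope.
Local Open Scope ring_scope.

(** * Real and complex scalars *)

(* K is R or R[i], with ofR the inclusion of the reals and re the real part:
   inequalities are proved in R, where the Hilbert space is a real one. *)
Record scalars (R : realType) (K : numFieldType) (conj : {rmorphism K -> K}) :=
  Scalars {
  ofR : {rmorphism R -> K};
  re : K -> R;
  ler_ofR : forall r s, (ofR r <= ofR s) = (r <= s);
  reD : forall x y, re (x + y) = re x + re y;
  reZ : forall r x, re (ofR r * x) = r * re x;
  re1 : re 1 = 1;
  conjK : involutive conj;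
  addcK : forall x, x + conj x = ofR (2 * re x);
  mulcK : forall x, x * conj x = `|x| ^+ 2;
  conj_ofR : forall r, conj (ofR r) = ofR r;
  ge0_ofR : forall x, 0 <= x -> x = ofR (re x) }.

Lemma real_scalars (R : realType) :
  @scalars R R (idfun : {rmorphism R -> R}).
Proof.
exists (idfun : {rmorphism R -> R}) idfun => //=.
- by move=> x; ring.
- by move=> x; rewrite real_normK ?num_real// expr2.
Qed.

Lemma complex_scalars (R : realType) :
  @scalars R R[i] (Num.conj : {rmorphism R[i] -> R[i]}).
Proof.
exists (real_complex R : {rmorphism R -> R[i]}) (@complex.Re R).
- exact: lecR.
- by case=> ? ? [].
- by move=> r [a b] /=; rewrite mul0r subr0.
- by [].
- exact: conjCK.
- by move=> x; rewrite (addcJ x) rmorphM rmorph_nat.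
- by move=> x; rewrite normCK.
- by move=> r; apply: conjc_real.
- by move=> [a b]; rewrite lecE/= => /andP[/eqP -> _].
Qed.

Section EffectAutomorphisms.
Variables (R : realType) (K : numFieldType) (conj : {rmorphism K -> K}).
Variable st : scalars R conj.

Local Notation ofR := (ofR st).
Local Notation re := (re st).

Lemma re0 : re 0 = 0.
Proof. by rewrite -(mul0r 1) -(rmorph0 ofR) reZ mul0r. Qed.

Lemma reN x : re (- x) = - re x.
Proof. by apply/eqP; rewrite -addr_eq0 -reD addNr re0. Qed.

Lemma ofRK : cancel ofR re.
Proof. by move=> r; rewrite -[ofR r]mulr1 reZ re1 mulr1. Qed.

Lemma ofR_inj : injective ofR.
Proof. exact: can_inj ofRK. Qed.

Lemma ofR_eq0 r : (ofR r == 0) = (r == 0).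
Proof. by rewrite -(rmorph0 ofR) (inj_eq ofR_inj). Qed.

Lemma ofR_ge0 r : (0 <= ofR r) = (0 <= r).
Proof. by rewrite -(rmorph0 ofR) ler_ofR. Qed.

Lemma re_conj x : re (conj x) = re x.
Proof.
have /ofR_inj h : ofR (2 * re (conj x)) = ofR (2 * re x).
  by rewrite -!(addcK st) (conjK st) addrC.
lra.
Qed.

Lemma conj_fixed x : conj x = x -> x = ofR (re x).
Proof.
move=> xx; have := addcK st x; rewrite xx rmorphM rmorph_nat => e.
have : 2 * x = 2 * ofR (re x) by rewrite -e mulr_natl mulr2n.
by apply: mulfI; rewrite pnatr_eq0.
Qed.

Lemma re_eq0 x : (forall a, re (a * x) = 0) -> x = 0.
Proof.
move=> h; have := h (conj x); rewrite mulrC (mulcK st).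
have /(ge0_ofR st) e : 0 <= `|x| ^+ 2 by rewrite exprn_ge0.
by move=> e0; move: e; rewrite e0 rmorph0 => /eqP; rewrite sqrf_eq0 normr_eq0 => /eqP.
Qed.

Definition sqn x : R := re (x * conj x).

Lemma normK2 x : `|x| ^+ 2 = ofR (sqn x).
Proof. by rewrite /sqn (mulcK st); apply: ge0_ofR; rewrite exprn_ge0. Qed.

Lemma mul_conj x : x * conj x = ofR (sqn x).
Proof. by rewrite -normK2 (mulcK st). Qed.

Lemma sqn_ge0 x : 0 <= sqn x.
Proof. by rewrite -ofR_ge0 -normK2 exprn_ge0. Qed.

Lemma sqn_eq0 x : (sqn x == 0) = (x == 0).
Proof. by rewrite -ofR_eq0 -normK2 sqrf_eq0 normr_eq0. Qed.

Lemma sqn0 : sqn 0 = 0.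
Proof. by apply/eqP; rewrite sqn_eq0. Qed.

Lemma sqnM x y : sqn (x * y) = sqn x * sqn y.
Proof. by apply: ofR_inj; rewrite rmorphM -!normK2 normrM exprMn. Qed.

Lemma sqn_ofR r : sqn (ofR r) = r ^+ 2.
Proof. by rewrite /sqn (conj_ofR st) reZ ofRK expr2. Qed.

Lemma sqn_conj x : sqn (conj x) = sqn x.
Proof. by rewrite /sqn (conjK st) mulrC. Qed.

Lemma sqnD x y : sqn (x + y) = sqn x + sqn y + 2 * re (x * conj y).
Proof.
rewrite /sqn rmorphD mulrDl !mulrDr !reD.
have -> : re (y * conj x) = re (x * conj y).
  by rewrite -re_conj rmorphM (conjK st) mulrC.
lra.
Qed.

(* |s x + 1| = |x + 1| gives Re (s x) = Re x, so that s x is x or conj x;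
   additivity excludes a mixture of the two. *)
Lemma isometric_rmorphism (s : {rmorphism K -> K}) :
  (forall x, sqn (s x) = sqn x) -> s =1 id \/ s =1 conj.
Proof.
move=> hs.
have rs x : re (s x) = re x.
  have := hs (x + 1); rewrite rmorphD rmorph1 !sqnD hs rmorph1 !mulr1; lra.
have h x : s x = x \/ s x = conj x.
  (* Having the real part and the modulus of x, s x is a root of the real quadratic whose roots are
     x and conj x. *)
  have e : s x * s x - ofR (2 * re x) * s x + ofR (sqn x) = 0.
    have -> : ofR (2 * re x) = s x + conj (s x) by rewrite (addcK st) rs.
    have -> : ofR (sqn x) = s x * conj (s x) by rewrite mul_conj hs.
    by ring.
  have : (s x - x) * (s x - conj x) = 0.
    transitivity (s x * s x - (x + conj x) * s x + x * conj x); first by ring.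
    by rewrite (addcK st) mul_conj.
  by move=> /eqP; rewrite mulf_eq0 !subr_eq0 => /orP[]/eqP ->; [left|right].
have [[x0 hx0]|nh] := pselect (exists x, s x <> x); last first.
  by left=> x; apply: contrapT => ?; apply: nh; exists x.
right=> x; have [e|//] := h x; have [//|e0] := h x0.
have [|] := h (x + x0); rewrite rmorphD e e0.
  by move=> /addrI e1; case: hx0; rewrite e0.
by rewrite rmorphD => /addIr.
Qed.

(** * The underlying real Hilbert space *)

Variables (H : completeNormedModType K) (dot : {dot H for conj}).

(** Under the real part, the adjoint relations of linear and of conjugate-linear operators become
    one identity. *)
Definition rdot (x y : H) : R := re (dot x y).
Definition rscale (r : R) (x : H) : H := ofR r *: x.

Local Notation "''[' x , y ]" := (rdot x y).
Local Notation "''[' x ]" := (rdot x x).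
Local Notation "r *r: x" := (rscale r x) (at level 40).

Lemma dotC x y : dot x y = conj (dot y x).
Proof. by rewrite [LHS](@hermitian_subproof _ _ _ _ dot) expr0 mul1r. Qed.

Lemma dotZl a x y : dot (a *: x) y = a * dot x y.
Proof. by rewrite linearZl_LR. Qed.

Lemma dotZr a x y : dot x (a *: y) = conj a * dot x y.
Proof. by rewrite linearZr_LR. Qed.

Lemma dotDl x y z : dot (x + y) z = dot x z + dot y z.
Proof. exact: linearDl. Qed.

Lemma dotBl x y z : dot (x - y) z = dot x z - dot y z.
Proof. exact: linearBl. Qed.

Lemma dotBr x y z : dot z (x - y) = dot z x - dot z y.
Proof. exact: linearBr. Qed.

Lemma dotNl x z : dot (- x) z = - dot x z.
Proof. exact: linearNl. Qed.

Lemma dot0l z : dot 0 z = 0.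
Proof. exact: linear0l. Qed.

Definition dotE := (dotDl, dotNl, dotZl, dot0l).

Lemma rdotC x y : '[x, y] = '[y, x].
Proof. by rewrite /rdot dotC re_conj. Qed.

Lemma rdotDl x y z : '[x + y, z] = '[x, z] + '[y, z].
Proof. by rewrite /rdot linearDl reD. Qed.

Lemma rdotNl x z : '[- x, z] = - '[x, z].
Proof. by rewrite /rdot linearNl reN. Qed.

Lemma rdot0l z : '[0, z] = 0.
Proof. by rewrite /rdot linear0l re0. Qed.

Lemma rdotZl r x z : '[r *r: x, z] = r * '[x, z].
Proof. by rewrite /rdot dotZl (reZ st). Qed.

Lemma rdotDr x y z : '[z, x + y] = '[z, x] + '[z, y].
Proof. by rewrite !(rdotC z) rdotDl. Qed.

Lemma rdotNr x z : '[z, - x] = - '[z, x].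
Proof. by rewrite !(rdotC z) rdotNl. Qed.

Lemma rdot0r z : '[z, 0] = 0.
Proof. by rewrite !(rdotC z) rdot0l. Qed.

Lemma rdotZr r x z : '[z, r *r: x] = r * '[z, x].
Proof. by rewrite !(rdotC z) rdotZl. Qed.

Definition rdotE :=
  (rdotDl, rdotDr, rdotNl, rdotNr, rdotZl, rdotZr, rdot0l, rdot0r).

Lemma dot_rdot x : dot x x = ofR '[x].
Proof. by apply: conj_fixed; rewrite -dotC. Qed.

Lemma rdot_gt0 x : x != 0 -> 0 < '[x].
Proof.
move=> /(@neq0_dnorm_gt0 _ _ _ dot); rewrite dot_rdot lt_def => /andP[].
by rewrite ofR_eq0 ofR_ge0 => ? ?; rewrite lt_def; apply/andP.
Qed.

Lemma rdot_ge0 x : 0 <= '[x].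
Proof. by have [->|/rdot_gt0/ltW//] := eqVneq x 0; rewrite rdot0l. Qed.

Lemma rdot_eq0 x : '[x] = 0 -> x = 0.
Proof. by move=> e; apply: contrapT => /eqP /rdot_gt0; rewrite e ltxx. Qed.

Lemma rdot_inj x y : (forall z, '[x, z] = '[y, z]) -> x = y.
Proof.
move=> h; apply/eqP; rewrite -subr_eq0; apply/eqP/rdot_eq0.
by rewrite rdotDl rdotNl h subrr.
Qed.

Lemma nrscale x a : '[a *: x] = sqn a * '[x].
Proof.
apply: ofR_inj; rewrite rmorphM -mul_conj -!dot_rdot.
by rewrite dotZl dotZr mulrA.
Qed.

Lemma rscale1 x : 1 *r: x = x.
Proof. by rewrite /rscale rmorph1 scale1r. Qed.

Lemma rscaleA a b x : a *r: (b *r: x) = (a * b) *r: x.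
Proof. by rewrite /rscale rmorphM scalerA. Qed.

(** Source of the Cauchy-Schwarz inequalities below, including those of seminorms, which is why c
    may vanish. *)
Lemma quad_discr (a b c : R) : 0 <= c ->
  (forall t, 0 <= a + 2 * t * b + t ^+ 2 * c) -> b ^+ 2 <= a * c.
Proof.
move=> c0 h; have [e|n0] := eqVneq c 0.
  (* If b is nonzero, the affine function takes the value -1 at this t. *)
  have := h (- (a + 1) / (2 * b)); rewrite e mulr0 addr0 mulr0.
  have [-> _|b0] := eqVneq b 0; first by rewrite expr0n.
  have -> : 2 * (- (a + 1) / (2 * b)) * b = - (a + 1) by field.
  lra.
have := h (- b / c); rewrite -(ler_pM2r (x := c)) ?mul0r; last first.
  by rewrite lt_def n0.
have -> : (a + 2 * (- b / c) * b + (- b / c) ^+ 2 * c) * c = a * c - b ^+ 2.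
  by field.
lra.
Qed.

Lemma rCauchySchwarz x y : '[x, y] ^+ 2 <= '[x] * '[y].
Proof.
apply: quad_discr (rdot_ge0 _) _ => t.
have := rdot_ge0 (x + t *r: y); rewrite !rdotE (rdotC y x); lra.
Qed.

Hypothesis norm_dot : forall x : H, `|x| ^+ 2 = dot x x.

Definition rnorm (x : H) : R := re `|x|.

Lemma rnormE x : `|x| = ofR (rnorm x).
Proof. exact: ge0_ofR. Qed.

Lemma rnorm_ge0 x : 0 <= rnorm x.
Proof. by rewrite -ofR_ge0 -rnormE. Qed.

Lemma rnorm2 x : rnorm x ^+ 2 = '[x].
Proof.
by apply: ofR_inj; rewrite rmorphXn -rnormE norm_dot dot_rdot.
Qed.

Lemma rnormD x y : rnorm (x + y) <= rnorm x + rnorm y.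
Proof. by rewrite -(ler_ofR st) rmorphD -!rnormE ler_normD. Qed.

Lemma rnorm_lt e x : 0 < e -> '[x] < e ^+ 2 -> `|x| < ofR e.
Proof.
move=> e0; rewrite -rnorm2 ltr_pXn2r ?nnegrE ?rnorm_ge0 ?ltW// => h.
by rewrite rnormE lt_neqAle (ler_ofR st) (inj_eq ofR_inj) -lt_neqAle.
Qed.

(** Distances are squared and e is an explicit rate, which the limit inherits because the bound at n
    holds against all later terms. *)
Lemma complete_seq (u : nat -> H) (e : nat -> R) :
  (forall n m, (n <= m)%N -> '[u n - u m] <= e n) ->
  (forall d, 0 < d -> exists n, e n < d) ->
  exists x, forall n, '[u n - x] <= e n.
Proof.
move=> hu he.
have cu : cvg (u @ \oo).
  apply/cauchy_cvgP/cauchy_exP => eps eps0.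
  have epsE := ge0_ofR st (ltW eps0).
  have r0 : 0 < re eps.
    by rewrite lt_def -ofR_ge0 -epsE ltW// -ofR_eq0 -epsE gt_eqF.
  have [n hn] := he _ (exprn_gt0 2 r0).
  exists (u n), n => //= m /hu nm; rewrite -ball_normE/= epsE.
  by apply: rnorm_lt => //; apply: le_lt_trans hn.
exists (lim (u @ \oo)) => n; set l := lim _.
have e0 : 0 <= e n by apply: le_trans (hu n n _) => //; apply: rdot_ge0.
rewrite -rnorm2 -(sqr_sqrtr e0) ler_pXn2r ?nnegrE ?rnorm_ge0 ?sqrtr_ge0//.
apply/ler_addgt0Pr => d d0.
have od0 : 0 < ofR d by rewrite lt_def ofR_eq0 ofR_ge0 gt_eqF ?ltW.
have /cvgrPdist_lt /(_ _ od0) [m _ hm] := cu.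
have /hm /= {}hm := leq_maxr n m.
have -> : u n - l = (u n - u (maxn n m)) + (u (maxn n m) - l).
  by rewrite addrA subrK.
apply: le_trans (rnormD _ _) _; apply: lerD.
  rewrite -(ler_pXn2r (n := 2)) ?nnegrE ?rnorm_ge0 ?sqrtr_ge0//.
  by rewrite rnorm2 sqr_sqrtr// hu// leq_maxl.
by rewrite -(ler_ofR st) -rnormE distrC ltW.
Qed.

(** * Completeness: Lax-Milgram and uniform boundedness *)

Lemma le0_of_le_inv (x D : R) : (forall n, x <= D / n.+1%:R) -> x <= 0.
Proof.
move=> h; rewrite leNgt; apply/negP => x0.
have D0 : 0 < D by have := h 0%N; rewrite invr1 mulr1; apply: lt_le_trans.
have := archi_boundP (ltW (divr_gt0 D0 x0)); set n := Num.bound _.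
rewrite ltr_pdivrMr// => hn; have := h n; rewrite ler_pdivlMr//.
rewrite -natr1; lra.
Qed.

Definition rlinear (T : H -> H) :=
  (forall x y, T (x + y) = T x + T y) /\ (forall r x, T (r *r: x) = r *r: T x).

Definition rbounded (T : H -> H) :=
  exists2 C : R, 0 <= C & forall x, '[T x] <= C * '[x].

Definition rbounded_below (T : H -> H) :=
  exists2 c : R, 0 < c & forall x, c * '[x] <= '[T x].

Definition rfunctional (f : H -> R) :=
  [/\ forall x y, f (x + y) = f x + f y, forall r x, f (r *r: x) = r * f x
    & exists2 C : R, 0 <= C & forall x, f x ^+ 2 <= C * '[x]].

(* Symmetric Lax-Milgram: minimise the convex functional |M x|^2 - 2 f x. *)
Lemma lax_milgram (M : H -> H) (f : H -> R) :
  rlinear M -> rbounded M -> rbounded_below M -> rfunctional f ->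
  exists x, forall y, '[M x, M y] = f y.
Proof.
move=> [MD MZ] [B B0 hB] [c c0 hc] [fD fZ [C C0 hC]].
pose J x := '[M x] - 2 * f x.
(* Since (f x)^2 <= C |x|^2, the inequality of means gives 2 f x <= c |x|^2 + C / c. *)
have J_ge x : - (C / c) <= J x.
  have := hc x; have := hC x; have := rdot_ge0 x; rewrite /J.
  set n := '[x] => n0 h1 h2.
  suff : 2 * f x <= c * n + C / c by lra.
  have Cc : 0 <= C / c by rewrite divr_ge0// ltW.
  have e : C = C / c * c by rewrite divfK// gt_eqF.
  move: e Cc; set d := C / c => e Cc; rewrite e in h1.
  rewrite leNgt; apply/negP => h3.
  have p0 := mulr_ge0 (ltW c0) n0.
  have h4 : (c * n + d) ^+ 2 < (2 * f x) ^+ 2.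
    by rewrite ltr_pXn2r ?nnegrE//; lra.
  by have := sqr_ge0 (c * n - d); nra.
have JD x y : J (x + y) = J x + 2 * ('[M x, M y] - f y) + '[M y].
  by rewrite /J MD !rdotE fD (rdotC (M y)); lra.
pose m := inf (range J).
have hinf : has_inf (range J).
  by split; [exists (J 0), 0|exists (- (C / c)) => _ [x _ <-]].
have m_le x : m <= J x by apply: ge_inf; [exact: hinf.2|exists x].
have /choice[u hu] (n : nat) : exists x, J x < m + n.+1%:R^-1.
  have n0 : 0 < n.+1%:R^-1 :> R by rewrite invr_gt0 ltr0n.
  by have [_ [x _ <-] h] := inf_adherent n0 hinf; exists x.
(* At the midpoint, J equals (J x + J y) / 2 - |M (x - y)|^2 / 4 and is at least m. *)
have u_cauchy x y : '[M (x - y)] <= 2 * (J x - m) + 2 * (J y - m).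
  have := m_le (2^-1 *r: (x + y)).
  have -> : 2^-1 *r: (x + y) = x + (- 2^-1) *r: (x - y).
    by apply: rdot_inj => z; rewrite !rdotE; field.
  have : J y = J (x + -1 *r: (x - y)).
    by congr J; apply: rdot_inj => z; rewrite !rdotE; ring.
  rewrite !JD !MZ !rdotE !fZ; lra.
have invn (n k : nat) : (n <= k)%N -> k.+1%:R^-1 <= n.+1%:R^-1 :> R.
  by move=> nk; rewrite lef_pV2 ?posrE// ler_nat.
have [||l hl] := complete_seq (u := u)
  (e := fun n => 4 / c * n.+1%:R^-1).
- move=> n k nk; have := u_cauchy (u n) (u k); have := hc (u n - u k).
  have := hu n; have := hu k; have := invn _ _ nk => h1 h2 h3 h4 h5.
  rewrite -(ler_pM2l c0) [leRHS]mulrA (mulrCA c) divff ?gt_eqF// mulr1.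
  move: h1 h2 h3 h4 h5; move: (n.+1%:R^-1) (k.+1%:R^-1) => i j; lra.
- move=> d d0; have cd0 : 0 <= 4 / c / d by rewrite !divr_ge0// ltW.
  have := archi_boundP cd0; rewrite ltr_pdivrMr// => h.
  exists (Num.bound (4 / c / d)); rewrite ltr_pdivrMr ?ltr0n//.
  by apply: lt_trans h _; rewrite mulrC ltr_pM2l// ltr_nat.
exists l => y; apply/eqP; rewrite -subr_eq0 -sqrf_eq0; apply/eqP/le_anti.
rewrite sqr_ge0 andbT.
(* The constant comes from (p - w)^2 <= 2 p^2 + 2 w^2, where p = <M (u n), M y> - f y is small
   because [u n] almost minimises J, and w = <M (u n - l), M y> because [u n] is close to l. *)
apply: (@le0_of_le_inv _ ('[M y] * (2 + 8 * B / c))) => n.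
have q0 := rdot_ge0 (M y).
have h1 : ('[M (u n), M y] - f y) ^+ 2 <= n.+1%:R^-1 * '[M y].
  apply: quad_discr => // t; have := m_le (u n + t *r: y); have := hu n.
  rewrite JD MZ fZ !rdotE; move: (n.+1%:R^-1) (J (u n)) => i j; lra.
have h2 : '[M (u n - l), M y] ^+ 2 <= B * (4 / c * n.+1%:R^-1) * '[M y].
  apply: le_trans (rCauchySchwarz _ _) _; rewrite ler_wpM2r//.
  by apply: le_trans (hB _) _; rewrite ler_wpM2l.
have -> : '[M l, M y] - f y =
    '[M (u n), M y] - f y - '[M (u n - l), M y].
  have -> : M (u n) = M l + M (u n - l) by rewrite -MD addrCA subrr addr0.
  by rewrite !rdotE; ring.
move: h1 h2; set p := _ - f y; set w := '[M (u n - l), _]; set i := n.+1%:R^-1.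
have -> : 8 * B / c = 2 * (B * (4 / c)) by ring.
have -> : B * (4 / c * i) = B * (4 / c) * i by ring.
set g := B * (4 / c); have := sqr_ge0 (p + w). nra.
Qed.

(* Gliding hump (Sokal): along unit vectors w_n the signs in
   x = sum_n +- 3^-n w_n can be chosen so that |<x, z_n>| >= 3^-n |z_n| / 2. *)
Lemma weakly_bounded (Z : set H) :
  (forall v, exists M : R, forall z, Z z -> '[v, z] ^+ 2 <= M) ->
  exists2 C : R, 0 <= C & forall z, Z z -> '[z] <= C.
Proof.
move=> wb; apply: contrapT => unb.
(* The factor 3^n compensates the step length 3^-n and leaves n. *)
have /choice[g hg] (n : nat) : exists z, Z z /\ (n%:R * 3 ^+ n) ^+ 2 < '[z].
  apply: contrapT => h; apply: unb; exists ((n%:R * 3 ^+ n) ^+ 2).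
    exact: sqr_ge0.
  by move=> z Zz; rewrite leNgt; apply/negP => ?; apply: h; exists z.
have nu0 n : 0 < rnorm (g n).
  rewrite lt_def rnorm_ge0 andbT -sqrf_eq0 rnorm2// gt_eqF//.
  by apply: le_lt_trans (hg n).2; apply: sqr_ge0.
have nu n : n%:R * 3 ^+ n < rnorm (g n).
  rewrite -(ltr_pXn2r (n := 2)) ?nnegrE ?rnorm_ge0 ?mulr_ge0 ?exprn_ge0//.
  by rewrite rnorm2; exact: (hg n).2.
pose r n : R := 3 ^- n.
have r0 n : 0 < r n by rewrite invr_gt0 exprn_gt0.
have rS n : r n.+1 = r n / 3 by rewrite /r exprSr invfM.
(* With this sign the new term never cancels <x, g n>, so that |<u (n+1), g n>| >= 3^-n |g n|. *)
pose sg n x : R := if 0 <= '[x, g n] then 1 else -1.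
have sg2 n x : sg n x ^+ 2 = 1 by rewrite /sg; case: ifP; rewrite ?sqrrN expr1n.
pose a n x : R := sg n x * r n / rnorm (g n).
pose u := fix u n := if n is m.+1 then u m + a m (u m) *r: g m else 0 : H.
have uS n : u n.+1 = u n + a n (u n) *r: g n by [].
have g2 n : '[g n] = rnorm (g n) ^+ 2 by rewrite rnorm2.
have step n x : rnorm (a n x *r: g n) = r n.
  apply/eqP; rewrite -(@eqrXn2 _ 2) ?rnorm_ge0// ?ltW//.
  rewrite rnorm2 !rdotE g2 /a.
  rewrite -[X in _ == X]mul1r -[X in _ == X * _](sg2 n x).
  by apply/eqP; field; rewrite gt_eqF.
have tail n k : rnorm (u (n + k)%N - u n) <= 3 / 2 * (r n - r (n + k)%N).
  elim: k => [|k ih].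
    by rewrite addn0 !subrr mulr0 /rnorm normr0 re0.
  rewrite addnS uS addrAC; apply: le_trans (rnormD _ _) _.
  rewrite rS step; lra.
have [||x hx] := complete_seq (u := u)
  (e := fun n => (3 / 2 * r n) ^+ 2).
- move=> n k nk; have := tail n (k - n)%N; rewrite subnKC// => h.
  rewrite -opprB rdotNl rdotNr opprK -rnorm2.
  have := r0 n; have := r0 k => rk rn.
  rewrite ler_pXn2r ?nnegrE ?rnorm_ge0//; last by rewrite mulr_ge0 ?ltW.
  by apply: le_trans h _; lra.
- move=> d d0; have d1 : 0 <= d^-1 by rewrite invr_ge0 ltW.
  exists (Num.bound d^-1 + 1)%N; set n := (_ + 1)%N.
  have h1 : d^-1 < n%:R.
    by apply: lt_le_trans (archi_boundP d1) _; rewrite ler_nat leq_addr.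
  have h2 : n%:R < 3 ^+ n :> R by rewrite -natrX ltr_nat ltn_expl.
  have h3 : r n < d.
    by rewrite /r invf_plt ?posrE ?exprn_gt0//; apply: lt_trans h2.
  have h4 : r n <= 3^-1.
    by rewrite /r lef_pV2 ?posrE ?exprn_gt0// -[leLHS]expr1 ler_eXn2l ?ltr1n// /n addn1.
  have := r0 n; nra.
have [M hM] := wb x.
(* Then n / 2 > |M| + 1, whose square exceeds M. *)
pose n := (2 * (Num.bound `|M| + 1))%N.
have := hM _ (hg n).1.
(* The terms after step n have total length at most 3/2 * 3^-(n+1) = 3^-n / 2, half of what step n
   contributed. *)
have h1 : '[u n.+1 - x, g n] ^+ 2 <= (r n / 2 * rnorm (g n)) ^+ 2.
  apply: le_trans (rCauchySchwarz _ _) _.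
  rewrite g2 exprMn ler_pM2r ?exprn_gt0//.
  by apply: le_trans (hx _) _; rewrite rS le_eqVlt; apply/orP; left; apply/eqP; field.
have h2 : (r n * rnorm (g n)) ^+ 2 <= '[u n.+1, g n] ^+ 2.
  have rn : 0 < r n * rnorm (g n) by rewrite mulr_gt0.
  rewrite uS rdotDl rdotZl g2 /a.
  have -> : sg n (u n) * r n / rnorm (g n) * rnorm (g n) ^+ 2 =
    sg n (u n) * (r n * rnorm (g n)) by field; rewrite gt_eqF.
  move: rn; rewrite /sg; set p := '[_, _]; set q := r n * _.
  by case: (leP 0 p); nra.
have h3 : n%:R < r n * rnorm (g n).
  by have := nu n; rewrite mulrC -ltr_pdivlMl ?exprn_gt0// mulrC.
have h4 : `|M| + 1 < 2^-1 * n%:R.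
  rewrite natrM natrD mulrA mulVf// mul1r ltrD2r.
  exact: archi_boundP.
have h5 := ler_norm M.
move: h1 h2; have -> : '[x, g n] = '[u n.+1, g n] - '[u n.+1 - x, g n].
  by rewrite !rdotE; ring.
have -> : r n / 2 * rnorm (g n) = r n * rnorm (g n) / 2 by ring.
move: h3 h4 h5; have := normr_ge0 M.
move: (n%:R) (`|M|) (r n * _) '[u n.+1, g n] '[u n.+1 - x, g n] => N m q p w.
move=> m0 h3 h4 h5 h1 h2 h6.
have qm : m + 1 < q / 2 by lra.
have h7 : (q / 2) ^+ 2 <= (p - w) ^+ 2.
  have w1 : w <= q / 2 by nra.
  have w2 : - (q / 2) <= w by nra.
  have [p1|p1] : q <= p \/ p <= - q.
    have [p0|p0] := leP 0 p; [left|right]; nra.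
  - nra.
  - nra.
nra.
Qed.

Lemma riesz (f : H -> R) : rfunctional f -> exists v, forall y, '[v, y] = f y.
Proof.
apply: (lax_milgram (M := id)) => //.
- by exists 1 => // x; rewrite mul1r.
- by exists 1 => // x; rewrite mul1r.
Qed.

(** [lax_milgram] for y |-> <h, M y> makes M x - h orthogonal to the range of M, hence a zero of the
    adjoint N. *)
Lemma bounded_below_surj (M N : H -> H) :
  rlinear M -> rbounded M -> rbounded_below M ->
  (forall x y, '[M x, y] = '[x, N y]) -> (forall y, N y = 0 -> y = 0) ->
  forall h, exists x, M x = h.
Proof.
move=> lM bM bbM MN N0 h.
have [C C0 hC] := bM.
have [|x hx] := lax_milgram (f := fun y => '[h, M y]) lM bM bbM.
  split; [by move=> x y; rewrite lM.1 rdotDr| |].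
    by move=> r x; rewrite lM.2 rdotZr.
  exists ('[h] * C); first by rewrite mulr_ge0 ?rdot_ge0.
  move=> x; apply: le_trans (rCauchySchwarz _ _) _.
  by rewrite -mulrA ler_wpM2l ?rdot_ge0.
exists x; apply/eqP; rewrite -subr_eq0; apply/eqP/N0.
apply: rdot_inj => z.
by rewrite rdot0l rdotC -MN rdotC !rdotE hx subrr.
Qed.

(** * Semilinear operators and adjoints *)

Definition id_or_conj (s : K -> K) := s =1 id \/ s =1 conj.

Definition semilin (s : K -> K) (T : H -> H) :=
  forall a x y, T (a *: x + y) = s a *: T x + T y.

Lemma rdotZ_conj a x y : '[a *: x, y] = '[x, conj a *: y].
Proof. by rewrite /rdot dotZl dotZr (conjK st). Qed.

(** Cauchy-Schwarz for <A (B y), y> gives |B y|^4 <= C |B y|^2 |y|^2. *)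
Lemma radjoint_bounded (A B : H -> H) :
  (forall x y, '[A x, y] = '[x, B y]) -> rbounded A -> rbounded B.
Proof.
move=> AB [C C0 hC]; exists C => // y.
have := rCauchySchwarz (A (B y)) y; rewrite AB.
have := hC (B y); have := rdot_ge0 (B y); have := rdot_ge0 y.
have := rdot_ge0 (A (B y)).
move: '[B y] '[y] '[A _] => a b c c0 b0 a0 h1 h2.
have [->|an0] := eqVneq a 0; first by rewrite mulr_ge0.
have a1 : 0 < a by rewrite lt_def an0.
rewrite -(ler_pM2l a1); nra.
Qed.

Section Twist.
Variable s : {rmorphism K -> K}.
Hypothesis sP : id_or_conj s.

Lemma twist_ofR r : s (ofR r) = ofR r.
Proof. by case: sP => ->//; rewrite (conj_ofR st). Qed.

Lemma twistK z : s (s z) = z.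
Proof. by case: sP => ss; rewrite !ss// (conjK st). Qed.

Lemma re_twist z : re (s z) = re z.
Proof. by case: sP => ->//; rewrite re_conj. Qed.

Lemma twist_conj z : s (conj z) = conj (s z).
Proof. by case: sP => ss; rewrite !ss. Qed.

Variable T : H -> H.
Hypothesis sT : semilin s T.

Lemma semilinear0 : T 0 = 0.
Proof.
have /eqP := sT 1 0 0.
by rewrite rmorph1 !scale1r addr0 -[X in X == _]addr0 (inj_eq (addrI _)) eq_sym => /eqP.
Qed.

Lemma semilinearD x y : T (x + y) = T x + T y.
Proof. by have := sT 1 x y; rewrite rmorph1 !scale1r. Qed.

Lemma semilinearZ a x : T (a *: x) = s a *: T x.
Proof. by have := sT a x 0; rewrite semilinear0 !addr0. Qed.

Lemma semilinear_rlinear : rlinear T.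
Proof.
split=> [|r x]; first exact: semilinearD.
by rewrite /rscale semilinearZ twist_ofR.
Qed.

Lemma continuous_rbounded : continuous T -> rbounded T.
Proof.
move=> /(_ 0); rewrite /continuous_at semilinear0.
move=> /cvgrPdist_lt /(_ 1 ltr01) /nbhs_ballP [e /= e0].
rewrite -ball_normE /= => h.
have eE := ge0_ofR st (ltW e0).
set d := re e in eE.
have d0 : 0 < d.
  by rewrite lt_def -ofR_ge0 -eE ltW// -ofR_eq0 -eE gt_eqF.
exists (4 / d ^+ 2) => [|x]; first by rewrite divr_ge0// sqr_ge0.
have [->|x0] := eqVneq x 0; first by rewrite semilinear0 !rdot0l mulr0.
have n0 : 0 < rnorm x.
  rewrite lt_def rnorm_ge0 andbT -sqrf_eq0 rnorm2 gt_eqF//.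
  exact: rdot_gt0.
pose t := d / 2 / rnorm x.
have t0 : 0 < t by rewrite !divr_gt0.
have /h : `|0 - t *r: x| < e.
  rewrite eE sub0r normrN; apply: rnorm_lt => //.
  rewrite !rdotE -rnorm2.
  have -> : t * (t * rnorm x ^+ 2) = (d / 2) ^+ 2 by rewrite /t; field; rewrite gt_eqF.
  nra.
rewrite sub0r normrN semilinear_rlinear.2 rnormE -(rmorph1 ofR).
rewrite lt_neqAle (ler_ofR st) => /andP[_].
rewrite -(ler_pXn2r (n := 2)) ?nnegrE ?rnorm_ge0// rnorm2 !rdotE.
rewrite -(rnorm2 x) expr1n.
have dE : d = 2 * t * rnorm x by rewrite /t; field; rewrite gt_eqF.
move=> h1; have -> : 4 / d ^+ 2 * rnorm x ^+ 2 = (t * t)^-1.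
  by rewrite dE; field; rewrite !gt_eqF.
have tt0 : 0 < t * t := mulr_gt0 t0 t0.
by rewrite -[leRHS]mulr1 ler_pdivlMl// -mulrA.
Qed.

Lemma rbounded_continuous : rbounded T -> continuous T.
Proof.
move=> [C C0 hC] x; apply/cvgrPdist_lt => e e0.
have eE := ge0_ofR st (ltW e0).
set d := re e in eE.
have d0 : 0 < d.
  by rewrite lt_def -ofR_ge0 -eE ltW// -ofR_eq0 -eE gt_eqF.
pose g := d / (C + 1).
have C1 : 0 < C + 1 by rewrite ltr_wpDl.
have g0 : 0 < g by rewrite divr_gt0.
have G0 : 0 < ofR g by rewrite lt_def ofR_eq0 ofR_ge0 gt_eqF ?ltW.
apply/nbhs_ballP; exists (ofR g) => //= y.
rewrite -ball_normE /= rnormE lt_neqAle (ler_ofR st) => /andP[_ h].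
have -> : T x - T y = T (x - y).
  by rewrite -scaleN1r addrC -[in RHS]scaleN1r [in RHS]addrC sT rmorphN1.
rewrite eE; apply: rnorm_lt => //.
apply: le_lt_trans (hC _) _.
rewrite -rnorm2.
have n0 := rnorm_ge0 (x - y).
have h2 : rnorm (x - y) ^+ 2 <= g ^+ 2 by rewrite ler_pXn2r// nnegrE ltW.
have dE : d = g * (C + 1) by rewrite /g divfK// gt_eqF.
rewrite dE; apply: le_lt_trans (_ : C * g ^+ 2 < _); first by rewrite ler_wpM2l.
by rewrite [ltRHS]exprMn mulrC ltr_pM2l ?exprn_gt0//; nra.
Qed.

Lemma radjoint_exists : rbounded T ->
  exists A, [/\ forall x y, '[T x, y] = '[x, A y], semilin s A & rbounded A].
Proof.
move=> [C C0 hC].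
have /choice[A hA] y : exists v, forall x, '[v, x] = '[y, T x].
  apply: (riesz (f := fun x => '[y, T x])).
  split=> [u v|r u|]; first by rewrite semilinearD rdotDr.
    by rewrite semilinear_rlinear.2 rdotZr.
  exists ('[y] * C); first by rewrite mulr_ge0 ?rdot_ge0.
  move=> u; apply: le_trans (rCauchySchwarz _ _) _.
  by rewrite -mulrA ler_wpM2l ?rdot_ge0.
have TA x y : '[T x, y] = '[x, A y] by rewrite rdotC -hA rdotC.
exists A; split => // [a x y|].
  apply: rdot_inj => z.
  rewrite hA !rdotDl hA (rdotZ_conj (s a)) hA semilinearZ twist_conj twistK.
  by rewrite -rdotZ_conj.
exact: radjoint_bounded TA (ex_intro2 _ _ C C0 hC).
Qed.

(** Replacing x by its scalar multiples recovers the K-valued relation from its real part; the twist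
    s produces the linear or the conjugate-linear convention. *)
Lemma dot_radjoint A : (forall x y, '[T x, y] = '[x, A y]) ->
  forall x y, dot (T x) y = s (dot x (A y)).
Proof.
move=> TA x y; apply/eqP; rewrite -subr_eq0; apply/eqP/(re_eq0) => a.
rewrite mulrBr reD reN -dotZl.
have := TA (s a *: x) y; rewrite semilinearZ twistK /rdot => ->.
rewrite dotZl -(re_twist (s a * _)) rmorphM twistK; exact: subrr.
Qed.

End Twist.

(** * Effects *)

Definition symmetric_op (A : H -> H) := forall x y, '[A x, y] = '[x, A y].

Definition effect (A : H -> H) :=
  [/\ semilin idfun A, symmetric_op A, forall x, 0 <= '[A x, x]
    & forall x, '[A x, x] <= '[x]].

Lemma id_or_conj_id : id_or_conj idfun.
Proof. by left. Qed.

Lemma linear_rlinear A : semilin idfun A -> rlinear A.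
Proof.
exact: (@semilinear_rlinear idfun id_or_conj_id).
Qed.

Lemma psd_CauchySchwarz A : rlinear A -> symmetric_op A ->
  (forall x, 0 <= '[A x, x]) ->
  forall x y, '[A x, y] ^+ 2 <= '[A x, x] * '[A y, y].
Proof.
move=> [AD AZ] As A0 x y; apply: quad_discr => // t.
have := A0 (x + t *r: y); rewrite AD AZ !rdotE (As y) (rdotC y); lra.
Qed.

(** This is A^2 <= A, by Cauchy-Schwarz for the form of A at x and A x, together with A <= I. *)
Lemma effect_sqr A : effect A -> forall x, '[A x] <= '[A x, x].
Proof.
move=> [/linear_rlinear Al As A0 A1] x.
have := psd_CauchySchwarz Al As A0 x (A x); have := A1 (A x); have := A0 x.
have := rdot_ge0 (A x).
move: '[A x] '[A x, x] '[A (A x), A x] => a b c a0 b0 ca h.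
have [->//|an0] := eqVneq a 0.
have a1 : 0 < a by rewrite lt_def an0.
rewrite -(ler_pM2l a1); nra.
Qed.

(** The inequality A^2 <= A is positivity of the relation of A, <A x, x - A x> >= 0, which is the
    property that phi_T visibly preserves. *)
Lemma effectI A : semilin idfun A -> symmetric_op A ->
  (forall x, '[A x] <= '[A x, x]) -> effect A.
Proof.
move=> Al As h; have A0 x : 0 <= '[A x, x].
  by apply: le_trans (h x); apply: rdot_ge0.
split=> // x; have := rCauchySchwarz (A x) x.
have := h x; have := A0 x; have := rdot_ge0 x.
move: '[A x] '[A x, x] '[x] => a b c c0 b0 ab h2.
have [->//|bn0] := eqVneq b 0.
have b1 : 0 < b by rewrite lt_def bn0.
rewrite -(ler_pM2l b1); nra.
Qed.

Lemma effect_bounded A : effect A -> rbounded A.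
Proof.
move=> eA; exists 1 => // x; rewrite mul1r.
by apply: le_trans (effect_sqr eA x) _; case: eA.
Qed.

Lemma bounded_linearP (A : H -> H) :
  bounded_linear A <-> semilin idfun A /\ rbounded A.
Proof.
split=> -[lA bA]; split=> //.
  exact: (continuous_rbounded id_or_conj_id lA bA).
exact: (rbounded_continuous lA bA).
Qed.

Lemma bounded_conj_linearP (A : H -> H) :
  bounded_conj_linear conj A <-> semilin conj A /\ rbounded A.
Proof.
have cc : id_or_conj conj by right.
split=> -[lA bA]; split=> //; first exact: (continuous_rbounded cc lA bA).
exact: (rbounded_continuous lA bA).
Qed.

Lemma selfadjointP A :
  selfadjoint dot A <-> [/\ semilin idfun A, rbounded A & symmetric_op A].
Proof.
split.
  move=> [/bounded_linearP [lA bA] _ As]; split=> // x y.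
  by rewrite /rdot As.
move=> [lA bA As].
have bl : bounded_linear A by apply/bounded_linearP.
by split => // x y; rewrite (dot_radjoint id_or_conj_id lA As).
Qed.

Lemma op_geP B : symmetric_op B -> semilin idfun B ->
  op_ge0 dot B <-> forall x, 0 <= '[B x, x].
Proof.
move=> Bs lB; have e x : dot (B x) x = ofR '[B x, x].
  apply: conj_fixed; rewrite -dotC.
  by rewrite (dot_radjoint id_or_conj_id lB Bs).
by split=> h x; have := h x; rewrite e ofR_ge0.
Qed.

Lemma symmetric_sub A B : symmetric_op A -> symmetric_op B ->
  symmetric_op (B \- A).
Proof. by move=> As Bs x y; rewrite /= !rdotE As Bs. Qed.

Lemma linear_sub A B : semilin idfun A -> semilin idfun B ->
  semilin idfun (B \- A).
Proof.
move=> lA lB a x y; rewrite /= lA lB scalerBr opprD !addrA; congr (_ - _).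
by rewrite -!addrA; congr (_ + _); rewrite addrC.
Qed.

Lemma op_leP' A B : semilin idfun A -> symmetric_op A ->
  semilin idfun B -> symmetric_op B ->
  op_le dot A B <-> forall x, '[A x, x] <= '[B x, x].
Proof.
move=> lA As lB Bs; rewrite /op_le op_geP; last 2 first.
- exact: symmetric_sub.
- exact: linear_sub.
by split=> h x; have := h x; rewrite /= rdotDl rdotNl subr_ge0.
Qed.

Lemma effectsP A : effects dot A <-> effect A.
Proof.
have l0 : semilin idfun (cst 0 : H -> H).
  by move=> a x y; rewrite /= scaler0 addr0.
have s0 : symmetric_op (cst 0) by move=> x y; rewrite /= rdot0l rdot0r.
have l1 : semilin idfun (idfun : H -> H) by [].
have s1 : symmetric_op idfun by [].
split.
  move=> [/selfadjointP [lA bA As]].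
  move=> /(op_leP' l0 s0 lA As) h0 /(op_leP' lA As l1 s1) h1.
  by split=> // x; have := h0 x; rewrite /= rdot0l.
move=> eA; have [lA As A0 A1] := eA; split.
- by apply/selfadjointP; split=> //; apply: effect_bounded.
- by apply/(op_leP' l0 s0 lA As) => x; rewrite /= rdot0l.
- exact/(op_leP' lA As l1 s1).
Qed.

Lemma op_leP A B : effect A -> effect B ->
  op_le dot A B <-> forall x, '[A x, x] <= '[B x, x].
Proof. by move=> [? ? _ _] [? ? _ _]; apply: op_leP'. Qed.

Lemma effect_antisym A B : effect A -> effect B ->
  (forall x, '[A x, x] = '[B x, x]) -> A = B.
Proof.
move=> [/linear_rlinear[AD AZ] As _ _] [/linear_rlinear[BD BZ] Bs _ _] AB.
apply/funext => x; apply: rdot_inj => y.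
have := AB (x + y); rewrite AD BD !rdotE !AB.
rewrite (As y x) (Bs y x) !(rdotC y (_ x)); lra.
Qed.

(** [adjoint] may pick either alternative, but both have the same real part, which identifies the
    choice with A once some adjoint is known to exist. *)
Lemma adjointE (s : {rmorphism K -> K}) T A : id_or_conj s ->
  semilin s T -> rbounded T -> (forall x y, '[T x, y] = '[x, A y]) ->
  adjoint dot T = A.
Proof.
move=> sP sT bT TA.
have [A0 [TA0 sA bA]] := radjoint_exists sP sT bT.
have dA := dot_radjoint sP sT TA0.
have ex : is_linear_adjoint dot T A0 \/ is_conj_linear_adjoint dot T A0.
  case: sP => ss.
    left; split=> [||x y]; rewrite ?dA ?ss//;
    by apply/bounded_linearP; split=> // a x y; rewrite ?sT ?sA ss.
  right; split=> [||x y]; rewrite ?dA ?ss//;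
  by apply/bounded_conj_linearP; split=> // a x y; rewrite ?sT ?sA ss.
apply/funext => y; apply: rdot_inj => x.
rewrite !(rdotC _ x) -TA.
have := @xgetPex _ (cst 0) [set A | is_linear_adjoint dot T A \/
  is_conj_linear_adjoint dot T A] (ex_intro _ A0 ex).
rewrite -/(adjoint dot T).
by move=> [] [_ _ h]; rewrite /rdot h// re_conj.
Qed.

Lemma invertible_semilinearP (T : H -> H) :
  invertible_semilinear conj T <->
  bijective T /\ exists s : {rmorphism K -> K},
    [/\ id_or_conj s, semilin s T & rbounded T].
Proof.
split.
  move=> [bT [/bounded_linearP|/bounded_conj_linearP] [lT rT]]; split=> //.
    by exists idfun; split=> //; left.
  by exists conj; split=> //; right.
move=> [bT [s [sP sT rT]]]; split=> //; case: sP => ss; [left|right].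
  by apply/bounded_linearP; split=> // a x y; rewrite sT ss.
by apply/bounded_conj_linearP; split=> // a x y; rewrite sT ss.
Qed.

Lemma op_invE (A B : H -> H) : is_inverse A B -> op_inv A = B.
Proof.
move=> AB; have [_ K1 K2] := AB.
have [_ _ K3] := @xgetPex _ (cst 0) [set B | is_inverse A B] (ex_intro _ B AB).
by apply/funext => x; rewrite -[in RHS](K3 x) K1.
Qed.

(** * The maps phi_T *)

Lemma le_mul_of_le (a b C : R) : 0 <= C ->
  (forall e, 0 < e -> b <= C * (a + e)) -> b <= C * a.
Proof.
move=> C0 h; apply/ler_addgt0Pr => e e0.
have C1 : 0 < C + 1 by rewrite ltr_wpDl.
have d0 : 0 < e / (C + 1) by rewrite divr_gt0.
apply: le_trans (h _ d0) _; rewrite mulrDr lerD2l mulrA ler_pdivrMr//; nra.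
Qed.

(** Uniform boundedness on the set where q <= 1, then homogeneity. As q z may vanish a priori, z is
    rescaled by q z + e and e is sent to 0. *)
Lemma weakly_bounded_form (q : H -> R) :
  (forall x, 0 <= q x) -> (forall r x, q (r *r: x) = r ^+ 2 * q x) ->
  (forall v, exists2 M : R, 0 <= M & forall z, '[v, z] ^+ 2 <= M * q z) ->
  exists2 C : R, 0 <= C & forall z, '[z] <= C * q z.
Proof.
move=> q0 qZ h.
have [v|C C0 hC] := weakly_bounded (Z := [set z | q z <= 1]).
  have [M M0 hM] := h v; exists M => z /= qz.
  by apply: le_trans (hM z) _; rewrite -[leRHS]mulr1 ler_wpM2l.
exists C => // z; apply: le_mul_of_le => // e e0.
have d0 : 0 < q z + e by rewrite ltr_wpDl.
have i0 : 0 <= (q z + e)^-1 by rewrite invr_ge0 ltW.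
have /hC : q (Num.sqrt (q z + e)^-1 *r: z) <= 1.
  by rewrite qZ sqr_sqrtr// ler_pdivrMl// mulr1 lerDl ltW.
by rewrite !rdotE mulrA -expr2 sqr_sqrtr// ler_pdivrMl// mulrC.
Qed.

(* Ti = T^-1, Ta is the adjoint of T and Tb = Ta^-1. *)
Record iso_with_adjoint (s : {rmorphism K -> K}) (T Ti Ta Tb : H -> H) : Prop :=
  IsoWithAdjoint {
  iso_twist : id_or_conj s;
  iso_semilin : [/\ semilin s T, semilin s Ti, semilin s Ta & semilin s Tb];
  iso_bounded : [/\ rbounded T, rbounded Ti, rbounded Ta & rbounded Tb];
  isoK : cancel T Ti;
  isoVK : cancel Ti T;
  adjK : cancel Ta Tb;
  adjVK : cancel Tb Ta;
  iso_adj : forall x y, '[T x, y] = '[x, Ta y];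
  isoV_adj : forall x y, '[Ti x, y] = '[x, Tb y] }.

Lemma iso_inverse s T Ti Ta Tb :
  iso_with_adjoint s T Ti Ta Tb -> iso_with_adjoint s Ti T Tb Ta.
Proof.
by move=> [? [? ? ? ?] [? ? ? ?] ? ? ? ? ? ?]; split.
Qed.

Lemma semilin_inverse (s : {rmorphism K -> K}) T Ti : id_or_conj s ->
  semilin s T -> cancel T Ti -> cancel Ti T -> semilin s Ti.
Proof.
by move=> sP sT K1 K2 a x y; apply: (can_inj K1); rewrite sT !K2 (twistK sP).
Qed.

(* Uniform boundedness bounds T* from below, so that T* is onto and T has a
   bounded inverse; this replaces the open mapping theorem. *)
Lemma iso_exists (s : {rmorphism K -> K}) T : id_or_conj s -> bijective T ->
  semilin s T -> rbounded T -> exists Ti Ta Tb, iso_with_adjoint s T Ti Ta Tb.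
Proof.
move=> sP [Ti K1 K2] sT bT.
have [Ta [TTa sTa bTa]] := radjoint_exists sP sT bT.
have [TaD TaZ] : rlinear Ta := semilinear_rlinear sP sTa.
(* Weak boundedness holds since <v, z> = <T (Ti v), z> = <Ti v, Ta z>. *)
have [|r x|v|C C0 hC] := weakly_bounded_form (q := fun u => '[Ta u]).
- by move=> x; apply: rdot_ge0.
- by rewrite TaZ !rdotE expr2 mulrA.
- exists '[Ti v]; first exact: rdot_ge0.
  by move=> z; rewrite -{1}(K2 v) TTa; apply: rCauchySchwarz.
have Ta_inj x y : Ta x = Ta y -> x = y.
  move=> e; apply/eqP; rewrite -subr_eq0; apply/eqP/(rdot_eq0).
  apply/le_anti; rewrite rdot_ge0 andbT; apply: le_trans (hC _) _.
  by rewrite -scaleN1r addrC sTa e rmorphN1 scaleN1r addNr rdot0l mulr0.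
have TaT x y : '[Ta x, y] = '[x, T y] by rewrite rdotC -TTa rdotC.
have /choice[Tb K4] : forall h, exists x, Ta x = h.
  apply: (bounded_below_surj (M := Ta) (N := T)) => //.
    have C1 : 0 < C + 1 by rewrite ltr_wpDl.
    exists (C + 1)^-1 => [|x]; first by rewrite invr_gt0.
    rewrite ler_pdivrMl//; apply: le_trans (hC x) _.
    by rewrite ler_wpM2r ?rdot_ge0// lerDl.
  move=> y e; apply: (can_inj K1).
  by rewrite e (semilinear0 sT).
have K3 : cancel Ta Tb by move=> x; apply: Ta_inj; rewrite K4.
have bTb : rbounded Tb.
  by exists C => // x; apply: le_trans (hC _) _; rewrite K4.
have TiTb x y : '[Ti x, y] = '[x, Tb y] by rewrite -{1}(K4 y) -TTa K2.
exists Ti, Ta, Tb; split=> //; split=> //.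
- exact: semilin_inverse K2.
- exact: semilin_inverse K4.
- apply: radjoint_bounded bTb => x y.
  by rewrite rdotC -TiTb rdotC.
Qed.

Lemma rboundedD A B : rbounded A -> rbounded B -> rbounded (A \+ B).
Proof.
move=> [a a0 ha] [b b0 hb]; exists (2 * a + 2 * b); first lra.
move=> x; have := ha x; have := hb x; have := rdot_ge0 (A x - B x).
rewrite /= !rdotE (rdotC (B x) (A x)); lra.
Qed.

Lemma rbounded_comp A B : rbounded A -> rbounded B -> rbounded (A \o B).
Proof.
move=> [a a0 ha] [b b0 hb]; exists (a * b); first exact: mulr_ge0.
by move=> x; apply: le_trans (ha _) _; rewrite -mulrA ler_wpM2l.
Qed.

Lemma rbounded_id : rbounded id.
Proof. by exists 1 => // x; rewrite mul1r. Qed.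

Lemma rboundedN A : rbounded A -> rbounded (\- A).
Proof.
by move=> [a a0 ha]; exists a => // x; rewrite /= rdotNl rdotNr opprK.
Qed.

(** Here n = |x|^2, z = |M x|^2, t = <P x, x> + |x|^2, v = |P x + 2 x|^2 and w = <M x, P x + 2 x>.
    Then n^2 <= C^2 w^2 <= C^2 D n z, and n is divided out; [D + 1] keeps the constant positive. *)
Lemma perturbation_bound (n z t v w C D : R) : 0 <= n -> 0 <= z ->
  0 < C -> 0 <= D -> n <= C * t -> v <= D * n -> w ^+ 2 <= z * v -> t <= w ->
  n <= (D + 1) * C ^+ 2 * z.
Proof.
move=> n0 z0 C0 D0 h3 h4 h5 h6.
have [->|nn0] := eqVneq n 0; first by rewrite !mulr_ge0 ?addr_ge0// ltW.
have n1 : 0 < n by rewrite lt_def nn0.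
have h7 : n <= C * w by apply: le_trans h3 _; rewrite ler_pM2l.
have h8 : n ^+ 2 <= C ^+ 2 * w ^+ 2.
  by rewrite -exprMn ler_pXn2r ?nnegrE//; apply: le_trans h7.
have h9 : w ^+ 2 <= (D + 1) * n * z.
  apply: le_trans h5 _; have := ler_wpM2l z0 h4.
  by have := mulr_ge0 z0 n0; lra.
have h10 : C ^+ 2 * w ^+ 2 <= C ^+ 2 * ((D + 1) * n * z).
  by rewrite ler_wpM2l// sqr_ge0.
rewrite -(ler_pM2l n1) -expr2; apply: le_trans h8 _.
by apply: le_trans h10 _; rewrite le_eqVlt; apply/orP; left; apply/eqP; ring.
Qed.

(** * Invertibility of I + X P for an effect X and I + P coercive *)

Section Perturbation.
Variables X P : H -> H.
Hypotheses (eX : effect X) (P_linear : semilin idfun P).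
Hypotheses (P_sym : symmetric_op P) (P_bounded : rbounded P).
Hypothesis P_below : exists2 C : R, 0 < C & forall x, '[x] <= C * ('[P x, x] + '[x]).

Let M x := x + X (P x).

(* With z = x + X P x, applying |X y|^2 <= <X y, y> to y = P x gives
   <P x, x> + |x|^2 <= <z, y> + 2 <z, x> - |z|^2. *)
Lemma effect_perturbation_below : rbounded_below M.
Proof.
have [C C0 hC] := P_below.
have [D D0 hD] : rbounded (P \+ (id \+ id)).
  exact: rboundedD P_bounded (rboundedD rbounded_id rbounded_id).
have d0 : 0 < (D + 1) * C ^+ 2 by rewrite mulr_gt0 ?exprn_gt0// ltr_wpDl.
exists ((D + 1) * C ^+ 2)^-1 => [|x]; first by rewrite invr_gt0.
rewrite ler_pdivrMl//.
have h1 := effect_sqr eX (P x).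
have h3 := hC x.
have h4 := hD x.
have h5 := rCauchySchwarz (M x) (P x + (x + x)).
have h6 : '[P x, x] + '[x] <= '[M x, P x + (x + x)].
  have := rdot_ge0 (M x); move: h1; rewrite /M !rdotE.
  rewrite (rdotC x (P x)) (rdotC x (X (P x))); lra.
rewrite /= in h4.
exact: (perturbation_bound (rdot_ge0 x) (rdot_ge0 (M x))
  C0 D0 h3 h4 h5 h6).
Qed.

Let X_linear : semilin idfun X. Proof. by case: eX. Qed.

Let M_linear : semilin idfun M.
Proof.
move=> a x y; rewrite /M P_linear X_linear scalerDr -!addrA.
by congr (_ + _); rewrite addrCA.
Qed.

(** M = I + X P is bounded below, and its adjoint I + P X is injective: if y + P X y = 0 then M (X
    y) = X (y + P X y) = 0, so X y = 0 and y = 0. *)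
Lemma effect_perturbation_inverse : exists B, is_inverse M B.
Proof.
have [_ Xs _ _] := eX.
have bX := effect_bounded eX.
have [c c0 hc] := effect_perturbation_below.
have [XD XZ] := linear_rlinear X_linear.
have M0 x : M x = 0 -> x = 0.
  move=> Mx; apply: rdot_eq0; apply/le_anti.
  rewrite rdot_ge0 andbT; have := hc x.
  by rewrite Mx rdot0l pmulr_rle0.
have N0 y : y + P (X y) = 0 -> y = 0.
  move=> Ny; have /M0 Xy : M (X y) = 0.
    by rewrite /M -XD Ny (semilinear0 X_linear).
  by move: Ny; rewrite Xy (semilinear0 P_linear) addr0.
have MN x y : '[M x, y] = '[x, y + P (X y)].
  by rewrite /M !rdotE Xs P_sym.
have bM : rbounded M.
  exact: rboundedD rbounded_id (rbounded_comp bX P_bounded).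
have /choice[B MB] := bounded_below_surj
  (linear_rlinear M_linear) bM effect_perturbation_below MN N0.
have BM : cancel M B.
  move=> x; apply/eqP; rewrite -subr_eq0; apply/eqP/M0.
  by rewrite addrC -scaleN1r M_linear MB scaleN1r addNr.
exists B; split=> //; apply/(bounded_linearP); split.
  exact: (semilin_inverse id_or_conj_id M_linear BM MB).
exists c^-1 => [|x]; first by rewrite invr_ge0 ltW.
by rewrite ler_pdivlMl//; apply: le_trans (hc _) _; rewrite MB.
Qed.

End Perturbation.

Section Phi.
Variables (s : {rmorphism K -> K}) (T Ti Ta Tb : H -> H).
Hypothesis iT : iso_with_adjoint s T Ti Ta Tb.
Variable X : H -> H.
Hypothesis eX : effect X.

Let X_linear : semilin idfun X. Proof. by case: eX. Qed.

Let phi_denomE : phi_denom dot T X = fun x => x + X (Ta (T x) - x).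
Proof.
case: iT => sP [sT _ _ _] [bT _ _ _] _ _ _ _ TTa _; apply/funext => x.
by rewrite /phi_denom (adjointE sP sT bT TTa) /= addrC.
Qed.

(** The case P = Ta T - I of the perturbation: I + P = Ta T is coercive because T has a bounded
    inverse. *)
Lemma phi_denom_inverse : exists B, is_inverse (phi_denom dot T X) B.
Proof.
have [sP [sT _ sTa _] [bT [C C0 hC] bTa _] K1 _ _ _ TTa _] := iT.
rewrite phi_denomE; apply: (effect_perturbation_inverse eX) => [a x y|x y||].
- rewrite sT sTa (twistK sP) scalerBr opprD !addrA; congr (_ - _).
  by rewrite -!addrA; congr (_ + _); rewrite addrC.
- by rewrite !rdotE -TTa (rdotC _ y) -TTa (rdotC (T y)).
- exact: rboundedD (rbounded_comp bTa bT) (rboundedN rbounded_id).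
exists (C + 1) => [|x]; first by rewrite ltr_wpDl.
rewrite !rdotE subrK rdotC -TTa mulrDl mul1r.
by rewrite -[leLHS]addr0 lerD ?rdot_ge0// -{1 2}(K1 x).
Qed.

(* phi_T(X) as a linear relation: T (+) T*^-1 maps the graph
   {(X x, x - X x)} to {(Y h, h - Y h)}. *)
Definition phi_rel (Y : H -> H) := forall x, Y (T (X x) + Tb (x - X x)) = T (X x).

(** Applying [Ta] turns the equation into (I + P X) x = Ta h with P = Ta T - I, solved by (I + P
    X)^-1 = I - P (I + X P)^-1 X. *)
Lemma phi_rel_total h : exists x, h = T (X x) + Tb (x - X x).
Proof.
have [sP [sT _ sTa sTb] [bT _ bTa _] K1 K2 K3 K4 TTa _] := iT.
have [B [_ MB BM]] := phi_denom_inverse.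
have [XD XZ] := linear_rlinear X_linear.
have [P hP] : exists P, forall u, P u = Ta (T u) - u.
  by exists (fun u => Ta (T u) - u).
pose g := Ta h.
pose x := g + -1 *r: P (B (X g)).
exists x; apply: (can_inj K3).
rewrite (semilinearD sTa) K4.
have -> : Ta (T (X x)) + (x - X x) = x + P (X x).
  by rewrite hP addrCA.
have e : X g = B (X g) + X (P (B (X g))) by rewrite -{1}(BM (X g)) phi_denomE -hP.
have -> : X x = B (X g).
  by rewrite /x XD XZ {1}e; apply: rdot_inj => z; rewrite !rdotE; ring.
by rewrite /x; apply: rdot_inj => z; rewrite !rdotE; ring.
Qed.

(** [Ta] sends the argument to (I + P X) x, and X (I + P X) = (I + X P) X cancels the inverse in the
    formula. *)
Lemma phi_op_rel : phi_rel (phi_op dot T X).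
Proof.
have [sP [sT _ sTa sTb] [bT _ bTa _] K1 K2 K3 K4 TTa _] := iT.
have [B iB] := phi_denom_inverse; have [_ MB BM] := iB.
have [XD XZ] := linear_rlinear X_linear.
move=> x; rewrite /phi_op (op_invE iB) (adjointE sP sT bT TTa) /=.
rewrite (semilinearD sTa) K4.
have -> : Ta (T (X x)) + (x - X x) = x + (Ta (T (X x)) - X x).
  by rewrite addrCA.
by have := MB (X x); rewrite phi_denomE -XD => ->.
Qed.

Lemma phi_rel_unique Y Y' : phi_rel Y -> phi_rel Y' -> Y = Y'.
Proof.
move=> h h'; apply/funext => y; have [x ->] := phi_rel_total y.
by rewrite h h'.
Qed.

(** Since <T u, Tb v> = <u, v>, the symmetry of the relation and <X x, x - X x> >= 0 pass from X to
    Y. *)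
Lemma phi_rel_effect Y : phi_rel Y -> effect Y.
Proof.
have [sP [sT _ sTa sTb] _ K1 K2 K3 K4 TTa _] := iT.
have [_ Xs _ _] := eX => h.
have TTb x y : '[T x, Tb y] = '[x, y] by rewrite TTa K4.
apply: effectI => [a y1 y2|y1 y2|y].
- have [x1 ->] := phi_rel_total y1; have [x2 ->] := phi_rel_total y2.
  rewrite !h; set x := s a *: x1 + x2.
  have e : X x = s a *: X x1 + X x2 by rewrite /x X_linear.
  have -> : a *: (T (X x1) + Tb (x1 - X x1)) + (T (X x2) + Tb (x2 - X x2)) =
            T (X x) + Tb (x - X x).
    have -> : x - X x = s a *: (x1 - X x1) + (x2 - X x2).
      by rewrite e /x scalerBr opprD !addrA; congr (_ - _); rewrite -!addrA;
         congr (_ + _); rewrite addrC.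
    by rewrite e sT sTb (twistK sP) scalerDr -!addrA; congr (_ + _); rewrite addrCA.
  by rewrite h e sT (twistK sP).
- have [x1 ->] := phi_rel_total y1; have [x2 ->] := phi_rel_total y2.
  rewrite !h !rdotDr !rdotDl !TTb (rdotC (Tb _)) TTb !rdotE.
  rewrite (Xs x2 x1) (rdotC x2 (X x1)) (rdotC (X x2)); ring.
- have [x ->] := phi_rel_total y; rewrite h rdotDr TTb !rdotE lerDl subr_ge0.
  exact: effect_sqr.
Qed.

End Phi.

(* Effects as positive relations: the order is that of the quadratic forms
   <X x, x - X x>, which T (+) T*^-1 preserves. *)
Lemma effect_le_relP X Z : effect X -> effect Z ->
  (forall x, '[X x, x] <= '[Z x, x]) ->
  forall x y, 2 * '[X x, y - Z y] <= '[X x, x - X x] + '[Z y, y - Z y].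
Proof.
move=> eX eZ XZ x y; have [/(linear_rlinear) lX Xs X0 _] := eX.
have [/(linear_rlinear)[ZD _] Zs _ Z1] := eZ.
have weak u : 2 * '[X x, u] <= '[X x, x] + '[Z u, u].
  have := X0 (x + -1 *r: u); have := XZ u; rewrite lX.1 lX.2 !rdotE.
  rewrite (Xs u x) (rdotC u (X x)); lra.
(* Using [weak] at y + v and <Z v, v> <= |v|^2 completes the square: the expansion of |v|^2 supplies
   the terms in |X x|^2, |Z y|^2 and <X x, Z y>. *)
have [v hv] : exists v, v = X x - Z y by exists (X x - Z y).
have e1 : '[v] = '[X x, v] - '[Z y, v] by rewrite {1}hv !rdotE.
have e2 : '[v] = '[X x] - 2 * '[X x, Z y] + '[Z y].
  by rewrite hv !rdotE (rdotC (Z y) (X x)); ring.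
have := weak (y + v); have := Z1 v; rewrite ZD !rdotE (Zs v y).
rewrite (rdotC v (Z y)); lra.
Qed.

(** Writing h in both relations, by x for X and by y for Z, the difference <W h, h> - <Y h, h> is <X
    x, x - X x> + <Z y, y - Z y> - 2 <X x, y - Z y> + |T (Z y) - T (X x)|^2, and [effect_le_relP]
    applies. *)
Lemma phi_rel_le s T Ti Ta Tb X Z Y W : iso_with_adjoint s T Ti Ta Tb ->
  effect X -> effect Z -> phi_rel T Tb X Y -> phi_rel T Tb Z W ->
  (forall x, '[X x, x] <= '[Z x, x]) -> forall h, '[Y h, h] <= '[W h, h].
Proof.
move=> iT eX eZ XY ZW XZ h; have [_ _ _ _ _ _ _ TTa _] := iT.
have [x hx] := phi_rel_total iT eX h; have [y hy] := phi_rel_total iT eZ h.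
have [_ _ _ _ _ _ K4 _ _] := iT.
have TTb u v : '[T u, Tb v] = '[u, v] by rewrite TTa K4.
have hY : Y h = T (X x) by rewrite [in LHS]hx XY.
have hW : W h = T (Z y) by rewrite [in LHS]hy ZW.
have e1 : '[Y h, h] = '[T (X x), T (Z y)] + '[X x, y - Z y].
  by rewrite hY {1}hy rdotDr TTb.
have e2 : '[W h, h] = '[T (X x), T (Z y)] + '[Z y, x - X x].
  by rewrite hW {1}hx rdotDr TTb rdotC.
have e3 : '[X x, x - X x] + '[Z y, y - Z y] - '[X x, y - Z y] - '[Z y, x - X x]
          = - '[T (Z y) - T (X x)].
  have : '[T (Z y) - T (X x), Tb (y - Z y) - Tb (x - X x)] =
         - '[T (Z y) - T (X x)].
    have -> : Tb (y - Z y) - Tb (x - X x) = - (T (Z y) - T (X x)).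
      have <- : h - T (Z y) = Tb (y - Z y) by rewrite [in LHS]hy addrC addKr.
      have <- : h - T (X x) = Tb (x - X x) by rewrite [in LHS]hx addrC addKr.
      by apply: rdot_inj => z; rewrite !rdotE; ring.
    by rewrite rdotNr.
  by rewrite rdotDl !rdotDr !rdotNl !rdotNr !TTb !rdotE => <-; ring.
have := rdot_ge0 (T (Z y) - T (X x)).
have := effect_le_relP eX eZ XZ x y; rewrite e1 e2; lra.
Qed.

Lemma phi_rel_inverse s T Ti Ta Tb X Y : iso_with_adjoint s T Ti Ta Tb ->
  effect X -> phi_rel T Tb X Y -> phi_rel Ti Ta Y X.
Proof.
move=> iT eX XY h; have [_ _ _ K1 _ _ K4 _ _] := iT.
have [x hx] := phi_rel_total iT eX h.
have hY : Y h = T (X x) by rewrite [in LHS]hx XY.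
rewrite hY K1; have -> : h - T (X x) = Tb (x - X x).
  by rewrite [in LHS]hx addrC addKr.
by rewrite K4 addrC subrK.
Qed.

(** * Rank-one effects *)

Definition effect_le (A B : H -> H) := forall x, '[A x, x] <= '[B x, x].

(* The effect t P, P the projection onto K u, in the parameter
   c = |u|^2 (1/t - 1). *)
Definition rank1 (u : H) (c : R) (z : H) : H := (dot z u * ofR ('[u] + c)^-1) *: u.

Lemma sqn_dotC x y : sqn (dot x y) = sqn (dot y x).
Proof. by rewrite dotC sqn_conj. Qed.

Lemma rdot_sqr_le x y : '[x, y] ^+ 2 <= sqn (dot x y).
Proof.
rewrite /rdot; move: (dot x y) => z.
have := sqn_ge0 (z - ofR (re z)).
have := sqnD z (- ofR (re z)).
rewrite -mulN1r sqnM sqn_ofR; have -> : sqn (-1) = 1.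
  by rewrite -(rmorph1 ofR) -rmorphN sqn_ofR sqrrN expr1n.
have e : re (z * ofR (re z)) = re z ^+ 2 by rewrite mulrC (reZ st) expr2.
rewrite mulN1r rmorphN (conj_ofR st) mulrN reN e => ->; lra.
Qed.

Lemma rdot_twist x y : '[conj (dot x y) *: x, y] = sqn (dot x y).
Proof. by rewrite /rdot dotZl mulrC. Qed.

Lemma rdotZZ a x y : '[a *: x, a *: y] = sqn a * '[x, y].
Proof. by rewrite rdotZ_conj scalerA mulrC mul_conj rdotZr. Qed.

(** Multiplying x by the conjugate of <A x, y> upgrades the real Cauchy-Schwarz inequality to one
    for the modulus. *)
Lemma psd_sqn (A : H -> H) : semilin idfun A -> symmetric_op A ->
  (forall x, 0 <= '[A x, x]) ->
  forall x y, sqn (dot (A x) y) <= '[A x, x] * '[A y, y].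
Proof.
move=> lA As A0 x y.
have Az a z : A (a *: z) = a *: A z by rewrite (semilinearZ lA).
have := psd_CauchySchwarz (linear_rlinear lA) As A0 (conj (dot (A x) y) *: x) y.
rewrite !Az rdot_twist rdotZZ sqn_conj.
have := sqn_ge0 (dot (A x) y); have := mulr_ge0 (A0 x) (A0 y).
move: (sqn _) => q ab0 q0; have [->//|qn0] := eqVneq q 0.
have q1 : 0 < q by rewrite lt_def qn0.
by move=> h; rewrite -(ler_pM2l q1) mulrA -expr2.
Qed.

Lemma dot_CauchySchwarz x y : sqn (dot x y) <= '[x] * '[y].
Proof.
by apply: (psd_sqn (A := id)) => // z; apply: rdot_ge0.
Qed.

(* m bounds the square of the norm of <., u> dual to the seminorm <A z, z>^(1/2). *)
Definition dual_bound (A : H -> H) (u : H) (m : R) :=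
  forall z, 2 * '[u, z] <= m + '[A z, z].

Lemma dual_boundP (A : H -> H) u m : semilin idfun A ->
  (forall x, 0 <= '[A x, x]) ->
  dual_bound A u m <-> 0 <= m /\ forall z, sqn (dot z u) <= m * '[A z, z].
Proof.
move=> lA A0; have [_ AZ] := linear_rlinear lA; split=> [h|[m0 h] z].
  have m0 : 0 <= m by have := h 0; rewrite !rdot0r mulr0 addr0.
  have h1 z : '[u, z] ^+ 2 <= m * '[A z, z].
    apply: quad_discr => // t; have := h (- t *r: z); rewrite AZ !rdotE.
    lra.
  split=> // z; have := h1 (conj (dot z u) *: z).
  rewrite rdotC rdot_twist (semilinearZ lA) /= rdotZZ sqn_conj.
  have := sqn_ge0 (dot z u); have := mulr_ge0 m0 (A0 z).
  move: (sqn _) => q ab0 q0; have [->//|qn0] := eqVneq q 0.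
  have q1 : 0 < q by rewrite lt_def qn0.
  by move=> h2; rewrite -(ler_pM2l q1) mulrA [q * m]mulrC -mulrA -expr2.
have h1 : '[u, z] ^+ 2 <= m * '[A z, z].
  by apply: le_trans (h z); rewrite sqn_dotC; apply: rdot_sqr_le.
have := A0 z; move: h1; set p := '[u, z]; set q := '[A z, z] => h1 q0.
rewrite leNgt; apply/negP => h2.
have h3 : (m + q) ^+ 2 < (2 * p) ^+ 2.
  by rewrite ltr_pXn2r ?nnegrE ?addr_ge0//; apply: le_trans (ltW h2); apply: addr_ge0.
have := sqr_ge0 (m - q); nra.
Qed.

(** Test at z = u. Hence m - |u|^2 is an admissible parameter of [rank1 u]. *)
Lemma dual_bound_ge A u m : effect A -> dual_bound A u m -> '[u] <= m.
Proof. by move=> [_ _ _ A1] /(_ u); have := A1 u; lra. Qed.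

Lemma rank1_dot u c z : '[rank1 u c z, z] = ('[u] + c)^-1 * sqn (dot z u).
Proof.
rewrite /rank1 /rdot dotZl mulrAC mulrC (reZ st); congr (_ * _).
by rewrite /sqn -dotC.
Qed.

Lemma rank1_sqr u c z :
  '[rank1 u c z] = (('[u] + c)^-1) ^+ 2 * sqn (dot z u) * '[u].
Proof. by rewrite /rank1 nrscale sqnM sqn_ofR; ring. Qed.

Section RankOne.
Variables (u : H) (c : R).
Hypotheses (u0 : u != 0) (c0 : 0 <= c).

Lemma rank1_den : 0 < '[u] + c.
Proof. by rewrite ltr_wpDr// rdot_gt0. Qed.

Lemma rank1_effect : effect (rank1 u c).
Proof.
have d := rank1_den.
apply: effectI => [a x y|x y|x].
- by rewrite /rank1 dotDl dotZl mulrDl scalerDl scalerA mulrA.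
- rewrite /rank1 /rdot dotZl dotZr rmorphM (conj_ofR st) -(dotC u y).
  by congr (re _); ring.
rewrite rank1_sqr rank1_dot expr2 -!mulrA ler_pM2l ?invr_gt0//.
rewrite mulrCA ler_piMr ?sqn_ge0// ler_pdivrMl// mulr1 lerDl//.
Qed.

(** Both sides say |<z, u>|^2 <= (|u|^2 + c) <A z, z> for all z. Through this equivalence an order
    automorphism acts on dual norms. *)
Lemma rank1_leP A : effect A ->
  effect_le (rank1 u c) A <-> dual_bound A u ('[u] + c).
Proof.
move=> [lA _ A0 _]; rewrite dual_boundP//; have d := rank1_den; split.
  move=> h; split=> [|z]; first exact: ltW.
  by have := h z; rewrite rank1_dot ler_pdivrMl.
by move=> [_ h] z; rewrite rank1_dot ler_pdivrMl.
Qed.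

Lemma rank1_neq0 : rank1 u c <> cst 0.
Proof.
move=> /(congr1 (fun f => f u)) /eqP.
rewrite /rank1 /= scaler_eq0 (negPf u0) orbF dot_rdot mulf_eq0 !ofR_eq0.
by rewrite invr_eq0 !gt_eqF ?rank1_den// rdot_gt0.
Qed.

Lemma rank1_scale a : a != 0 -> rank1 (a *: u) (sqn a * c) = rank1 u c.
Proof.
move=> a0; apply/funext => z; rewrite /rank1 scalerA; congr (_ *: _).
rewrite dotZr nrscale -mulrDr invfM rmorphM [ofR (sqn a)^-1]fmorphV -mul_conj.
by move: (ofR _^-1) => k; field; rewrite fmorph_eq0 a0.
Qed.

End RankOne.

Lemma effect_le_sqr A B z : effect A -> effect_le A B -> '[B z, z] <= 0 -> A z = 0.
Proof.
move=> eA AB Bz; apply: rdot_eq0; apply/le_anti.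
rewrite rdot_ge0 andbT; apply: le_trans (effect_sqr eA z) _.
exact: le_trans (AB z) Bz.
Qed.

Lemma orthogonal_rest u z : u != 0 ->
  dot (z - (dot z u * ofR '[u]^-1) *: u) u = 0.
Proof.
move=> u0; rewrite dotBl dotZl dot_rdot -mulrA -rmorphM mulVf ?rmorph1.
  by rewrite mulr1 subrr.
by rewrite gt_eqF// rdot_gt0.
Qed.

(** The component of u orthogonal to v is annihilated by the larger effect, so it is orthogonal to u
    as well, hence zero. *)
Lemma rank1_le_rank1 u c v d : u != 0 -> 0 <= c -> v != 0 -> 0 <= d ->
  effect_le (rank1 u c) (rank1 v d) -> exists2 a, a != 0 & u = a *: v.
Proof.
move=> u0 c0 v0 d0 h; pose a := dot u v * ofR '[v]^-1.
have e := orthogonal_rest u v0; rewrite -/a in e.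
set z := u - a *: v in e.
have hz : dot z u = 0.
  have := h z; rewrite !rank1_dot e sqn0 mulr0 => h1.
  apply/eqP; rewrite -sqn_eq0; apply/eqP/le_anti; rewrite sqn_ge0 andbT.
  by move: h1; rewrite pmulr_rle0 ?invr_gt0 ?rank1_den.
have z0 : z = 0.
  apply: rdot_eq0; rewrite /rdot.
  have -> : dot z z = dot z u - conj a * dot z v.
    by rewrite -dotZr -dotBr.
  by rewrite hz e mulr0 subr0 re0.
have uE : u = a *: v by apply/eqP; rewrite -subr_eq0 -/z z0.
by exists a => //; apply: contraNneq u0 => a0; rewrite uE a0 scale0r.
Qed.

Lemma rank1_le_same u c d : u != 0 -> 0 <= c -> 0 <= d ->
  effect_le (rank1 u c) (rank1 u d) <-> d <= c.
Proof.
move=> u0 c0 d0; have h1 := rank1_den u0 c0; have h2 := rank1_den u0 d0.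
have u1 := rdot_gt0 u0.
have s1 : 0 < sqn (dot u u) by rewrite dot_rdot sqn_ofR exprn_gt0.
split=> [/(_ u)|dc z]; rewrite !rank1_dot.
  by rewrite ler_pM2r// lef_pV2 ?posrE// lerD2l.
by rewrite ler_wpM2r ?sqn_ge0// lef_pV2 ?posrE// lerD2l.
Qed.

Lemma effect_rank1 A v : effect A -> A <> cst 0 -> v != 0 ->
  (forall z, dot z v = 0 -> A z = 0) -> exists2 d, 0 <= d & A = rank1 v d.
Proof.
move=> eA A0 v0 h; have [lA As Age0 A1] := eA.
have v1 := rdot_gt0 v0.
have AZ a z : A (a *: z) = a *: A z by rewrite (semilinearZ lA).
have AB x y : A (x - y) = A x - A y.
  by rewrite addrC -scaleN1r lA /= scaleN1r addrC.
have Av z : A z = (dot z v * ofR '[v]^-1) *: A v.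
  have := h _ (orthogonal_rest z v0); rewrite AB AZ => /eqP.
  by rewrite subr_eq0 => /eqP.
pose a := dot (A v) v * ofR '[v]^-1.
have Avv : A v = a *: v.
  have e := orthogonal_rest (A v) v0; rewrite -/a in e.
  set z := A v - a *: v in e.
  have hz : dot (A v) z = 0.
    by rewrite (dot_radjoint id_or_conj_id lA As) (h _ e) linear0r.
  have z0 : z = 0.
    apply: rdot_eq0; rewrite {1}/z rdotDl rdotNl.
    by rewrite /rdot hz dotZl dotC e rmorph0 mulr0 subrr.
  by apply/eqP; rewrite -subr_eq0 -/z z0.
pose r := '[A v, v] / '[v].
have aE : a = ofR r.
  rewrite /r rmorphM /a; congr (_ * _); apply: conj_fixed.
  by rewrite -dotC (dot_radjoint id_or_conj_id lA As).
have r0 : 0 < r.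
  rewrite lt_def divr_ge0 ?(ltW v1)// andbT; apply/eqP => re0; apply: A0.
  by apply/funext => z; rewrite Av Avv aE re0 rmorph0 scale0r scaler0.
have r1 : r <= 1 by rewrite ler_pdivrMr// mul1r.
(* A is r times the projection onto K v; this is the parameter of that multiple. *)
exists ('[v] * (r^-1 - 1)).
  by rewrite mulr_ge0 ?(ltW v1)// subr_ge0 invf_ge1.
apply/funext => z; rewrite Av Avv aE /rank1 scalerA; congr (_ *: _).
have -> : '[v] + '[v] * (r^-1 - 1) = '[v] / r by ring.
by rewrite -mulrA -rmorphM invf_div mulrC [r / _]mulrC mulrC.
Qed.

(** Phrased in the order alone, so that automorphisms preserve it. *)
Definition is_chain (A : H -> H) := A <> cst 0 /\
  forall X Y, effect X -> effect Y -> effect_le X A -> effect_le Y A ->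
    effect_le X Y \/ effect_le Y X.

Definition is_rank1 (A : H -> H) :=
  exists u c, [/\ u != 0, 0 <= c & A = rank1 u c].

(** This is <(A^-1 - I) v, v> at v = A y. *)
Definition excess A y : R := '[A y, y] - '[A y].

Lemma excess_ge0 A y : effect A -> 0 <= excess A y.
Proof. by move=> eA; rewrite subr_ge0 effect_sqr. Qed.

(* The largest rank-one minorant of A touching A in the direction y. *)
Lemma rank1_minorant A y : effect A -> A y != 0 ->
  effect_le (rank1 (A y) (excess A y)) A /\
  '[rank1 (A y) (excess A y) y, y] = '[A y, y].
Proof.
move=> eA Ay0; have [lA As A0 _] := eA.
have d0 := excess_ge0 y eA; have d := rank1_den Ay0 d0.
have e : '[A y] + excess A y = '[A y, y] by rewrite addrC subrK.
split=> [z|]; rewrite rank1_dot e; rewrite e in d.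
  rewrite ler_pdivrMl// sqn_dotC.
  exact: psd_sqn.
have e2 : dot (A y) y = ofR '[A y, y].
  by apply: conj_fixed; rewrite -dotC (dot_radjoint id_or_conj_id lA As).
have -> : dot y (A y) = ofR '[A y, y] by rewrite dotC e2 (conj_ofR st).
by rewrite sqn_ofR expr2 mulrA mulVf ?mul1r// gt_eqF.
Qed.

Lemma is_chainP A : effect A -> is_chain A <-> is_rank1 A.
Proof.
move=> eA; split.
  move=> [A0 ch].
  have [y0 Ay0] : exists y, A y != 0.
    apply: contrapT => h; apply: A0; apply/funext => y.
    by apply/eqP; apply: contrapT => /negP Ay; apply: h; exists y.
  (* The rank-one minorants touching A in the directions y0 and z are comparable, hence on one line;
     so the range of A is a line. *)
  have sp z : exists a, A z = a *: A y0.
    have [->|Az] := eqVneq (A z) 0; first by exists 0; rewrite scale0r.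
    have e1 := rank1_effect Ay0 (excess_ge0 y0 eA).
    have e2 := rank1_effect Az (excess_ge0 z eA).
    have [l1 _] := rank1_minorant eA Ay0; have [l2 _] := rank1_minorant eA Az.
    have [h|h] := ch _ _ e1 e2 l1 l2.
      have [a a0 ->] := rank1_le_rank1 Ay0 (excess_ge0 y0 eA) Az (excess_ge0 z eA) h.
      by exists a^-1; rewrite scalerA mulVf// scale1r.
    have [a a0 ->] := rank1_le_rank1 Az (excess_ge0 z eA) Ay0 (excess_ge0 y0 eA) h.
    by exists a.
  have [|d d0 ->] := effect_rank1 eA A0 Ay0; last by exists (A y0), d.
  move=> z hz; have [a Az] := sp z; apply: rdot_eq0.
  apply/le_anti; rewrite rdot_ge0 andbT; apply: le_trans (effect_sqr eA z) _.
  by rewrite Az /rdot dotZl dotC hz rmorph0 mulr0 re0.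
move=> [u [c [u0 c0 ->]]]; split; first exact: rank1_neq0.
have le_rank1 X : effect X -> effect_le X (rank1 u c) ->
    X = cst 0 \/ exists2 d, 0 <= d & X = rank1 u d.
  move=> eX Xu; have [->|X0] := pselect (X = cst 0); [by left|right].
  apply: effect_rank1 => // z hz; apply: effect_le_sqr eX Xu _.
  by rewrite rank1_dot hz sqn0 mulr0.
have zero_le X : effect X -> effect_le (cst 0) X.
  by move=> [_ _ X0 _] x; rewrite rdot0l.
move=> X Y eX eY hX hY.
have [->|[d d0 Xd]] := le_rank1 X eX hX; first by left; apply: zero_le.
have [->|[e e0 Ye]] := le_rank1 Y eY hY; first by right; apply: zero_le.
rewrite Xd Ye; have [de|/ltW ed] := leP d e.
  by right; apply/(rank1_le_same u0 e0 d0).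
by left; apply/(rank1_le_same u0 d0 e0).
Qed.

(** At z = u the dual bound gives |u|^2 <= <A u, u>, so |u - A u|^2 <= |u|^2 - <A u, u> <= 0. The
    condition A u = u being linear in u, the order sees spans. *)
Lemma rank1_0_leP u A : u != 0 -> effect A ->
  effect_le (rank1 u 0) A <-> A u = u.
Proof.
move=> u0 eA; have [lA As A0 A1] := eA.
rewrite rank1_leP// addr0; split=> [/(_ u) h|Au].
  apply/eqP; rewrite eq_sym -subr_eq0; apply/eqP/(rdot_eq0)/le_anti.
  rewrite rdot_ge0 andbT; have := effect_sqr eA u; have := A1 u.
  by rewrite !rdotE (rdotC u (A u)); lra.
apply/dual_boundP => //; split=> [|z]; first exact: rdot_ge0.
by have := psd_sqn lA As A0 u z; rewrite Au sqn_dotC.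
Qed.

Lemma rank1_determined A B : effect A -> effect B ->
  (forall u c, u != 0 -> 0 <= c -> effect_le (rank1 u c) A ->
    effect_le (rank1 u c) B) -> effect_le A B.
Proof.
move=> eA [_ _ B0 _] h y; have [->|Ay0] := eqVneq (A y) 0.
  by rewrite rdot0l.
have [l1 <-] := rank1_minorant eA Ay0.
by apply: h => //; apply: excess_ge0.
Qed.

(** The effect whose form X^-1 - I is |u|^2, finite on all of H. *)
Definition half_id : H -> H := fun x => 2^-1 *r: x.

Lemma half_effect : effect half_id.
Proof.
rewrite /half_id; apply: effectI => [a x y|x y|x].
- by rewrite /rscale scalerDr !scalerA mulrC.
- by rewrite !rdotE.
- by have := rdot_ge0 x; rewrite !rdotE; lra.
Qed.

Lemma rank1_half u c : u != 0 -> 0 <= c ->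
  effect_le (rank1 u c) half_id <-> '[u] <= c.
Proof.
move=> u0 c0; rewrite rank1_leP//; last exact: half_effect.
split=> [/(_ (2 *r: u))|h z]; rewrite /half_id !rdotE; first lra.
have := rdot_ge0 (u - 2^-1 *r: z); rewrite !rdotE (rdotC z u).
lra.
Qed.

(** * Dual norms and their parallelogram law *)

Section Diagonal.
Variables (a b : H) (p q : R).
Hypotheses (a0 : a != 0) (b0 : b != 0) (ab : dot a b = 0).
Hypotheses (p0 : 0 <= p) (q0 : 0 <= q).

Definition diag2 (z : H) := rank1 a p z + rank1 b q z.

Lemma diag2_effect : effect diag2.
Proof.
have [la As _ _] := rank1_effect a0 p0.
have [lb Bs _ _] := rank1_effect b0 q0.
have h := effect_sqr (rank1_effect a0 p0).
have h' := effect_sqr (rank1_effect b0 q0).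
rewrite /diag2; apply: effectI => [c x y|x y|x].
- by rewrite la lb scalerDr -!addrA; congr (_ + _); rewrite addrCA.
- by rewrite !rdotE As Bs.
rewrite !rdotE (rdotC (rank1 b q x)).
have -> : '[rank1 a p x, rank1 b q x] = 0.
  by rewrite /rdot /rank1 dotZl dotZr ab !mulr0 re0.
have := h x; have := h' x; lra.
Qed.

(** For invertible A, m is <A^-1 u, u>; as a least bound it also makes sense at vectors where A has
    no inverse, and the order can transport it. *)
Definition dual_norm (A : H -> H) (u : H) (m : R) :=
  dual_bound A u m /\ forall m', dual_bound A u m' -> m <= m'.

Lemma diag2_dual_norm (x y : R) :
  dual_norm diag2 (x *r: a + y *r: b) (x ^+ 2 * ('[a] + p) + y ^+ 2 * ('[b] + q)).
Proof.
have ma := rank1_den a0 p0; have mb := rank1_den b0 q0.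
have a1 := rdot_gt0 a0.
have b1 := rdot_gt0 b0.
have rab : '[a, b] = 0 by rewrite /rdot ab re0.
have aux (m t r w : R) : 0 < m -> r ^+ 2 <= w ->
    2 * (t * r) <= t ^+ 2 * m + m^-1 * w.
  move=> m0 rw; have : m^-1 * r ^+ 2 <= m^-1 * w by rewrite ler_pM2l// invr_gt0.
  have : 0 <= m^-1 * (t * m - r) ^+ 2 by rewrite mulr_ge0 ?sqr_ge0// invr_ge0 ltW.
  have -> : m^-1 * (t * m - r) ^+ 2 = t ^+ 2 * m - 2 * (t * r) + m^-1 * r ^+ 2.
    by field; rewrite gt_eqF.
  lra.
have dE z : '[diag2 z, z] =
    ('[a] + p)^-1 * sqn (dot z a) + ('[b] + q)^-1 * sqn (dot z b).
  by rewrite /diag2 rdotDl !rank1_dot.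
(* The bound is attained at the preimage of x a + y b under [diag2]. *)
split=> [z|m' /(_ ((x * ('[a] + p) / '[a]) *r: a + (y * ('[b] + q) / '[b]) *r: b))].
  rewrite dE !rdotE.
  have := @aux _ x '[a, z] _ ma; have := @aux _ y '[b, z] _ mb.
  have := rdot_sqr_le a z; have := rdot_sqr_le b z.
  rewrite (sqn_dotC a z) (sqn_dotC b z) => h1 h2 /(_ _ h1) h3 /(_ _ h2) h4.
  lra.
rewrite dE.
have ba : dot b a = 0 by rewrite dotC ab rmorph0.
rewrite /rscale !dotDl !dotZl ab ba !mulr0 addr0 add0r !dot_rdot -!rmorphM.
rewrite !sqn_ofR -!/(rscale _ _) !rdotE (rdotC b a) rab.
rewrite !divfK ?gt_eqF//.
have -> : ('[a] + p)^-1 * (x * ('[a] + p)) ^+ 2 = x ^+ 2 * ('[a] + p).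
  by field; rewrite gt_eqF.
have -> : ('[b] + q)^-1 * (y * ('[b] + q)) ^+ 2 = y ^+ 2 * ('[b] + q).
  by field; rewrite gt_eqF.
rewrite !mulr0 !addr0 !add0r.
lra.
Qed.

End Diagonal.

(** Test v at (z1 + z2) / 2 and w at (z1 - z2) / 2, and use the parallelogram law of the form of
    A. *)
Lemma dual_bound_parallelogram A v w m1 m2 z1 z2 : rlinear A ->
  dual_bound A v m1 -> dual_bound A w m2 ->
  (2 * '[v + w, z1] - '[A z1, z1]) + (2 * '[v - w, z2] - '[A z2, z2])
    <= 2 * m1 + 2 * m2.
Proof.
move=> [AD AZ] /(_ (2^-1 *r: z1 + 2^-1 *r: z2)) h1.
move=> /(_ (2^-1 *r: z1 + (- 2^-1) *r: z2)).
move: h1; rewrite !AD !AZ !rdotE; lra.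
Qed.

Lemma dual_norm_parallelogram_le A v w m1 m2 m3 m4 : rlinear A ->
  dual_norm A v m1 -> dual_norm A w m2 ->
  dual_norm A (v + w) m3 -> dual_norm A (v - w) m4 ->
  m3 + m4 <= 2 * m1 + 2 * m2.
Proof.
move=> lA [h1 _] [h2 _] [_ h3] [_ h4].
have h := dual_bound_parallelogram (A := A) _ _ lA h1 h2.
have : m4 <= 2 * m1 + 2 * m2 - m3; last lra.
apply: h4 => z2.
have : m3 <= 2 * m1 + 2 * m2 - (2 * '[v - w, z2] - '[A z2, z2]); last lra.
apply: h3 => z1; have := h z1 z2; lra.
Qed.

Lemma dual_norm_scale A v m r : rlinear A -> r != 0 ->
  dual_norm A v m -> dual_norm A (r *r: v) (r ^+ 2 * m).
Proof.
move=> [_ AZ] r0 [h1 h2].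
have aux (t : R) u k : t != 0 -> dual_bound A u k ->
    dual_bound A (t *r: u) (t ^+ 2 * k).
  move=> t0 h z; have := h (t^-1 *r: z); rewrite AZ !rdotE.
  have t2 : 0 < t ^+ 2 by rewrite lt_def sqr_ge0 sqrf_eq0 t0.
  rewrite -(ler_pM2l t2).
  have -> : t ^+ 2 * (2 * (t^-1 * '[u, z])) = 2 * (t * '[u, z]) by field.
  have -> : t ^+ 2 * (k + t^-1 * (t^-1 * '[A z, z])) = t ^+ 2 * k + '[A z, z] by field.
  by [].
split=> [|m' h]; first exact: aux.
have r2 : 0 < r ^+ 2 by rewrite lt_def sqr_ge0 sqrf_eq0 r0.
have := h2 (r^-1 ^+ 2 * m').
rewrite -(ler_pM2l r2) => h3; apply: le_trans (h3 _) _; last first.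
  by rewrite mulrA -exprMn divff// expr1n mul1r.
by rewrite -[v](rscale1) -(mulVf r0) -rscaleA; apply: aux => //; rewrite invr_eq0.
Qed.

(** The inequality for v + w and v - w, whose sum and difference are 2 v and 2 w, is the reverse
    inequality for v and w. *)
Lemma dual_norm_parallelogram A v w m1 m2 m3 m4 : rlinear A ->
  dual_norm A v m1 -> dual_norm A w m2 ->
  dual_norm A (v + w) m3 -> dual_norm A (v - w) m4 ->
  m3 + m4 = 2 * m1 + 2 * m2.
Proof.
move=> lA h1 h2 h3 h4; apply/le_anti.
rewrite (dual_norm_parallelogram_le lA h1 h2 h3 h4) /=.
have two : (2 : R) != 0 by rewrite pnatr_eq0.
have h1' := dual_norm_scale lA two h1; have h2' := dual_norm_scale lA two h2.
have e1 : (v + w) + (v - w) = 2 *r: v.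
  by apply: rdot_inj => z; rewrite !rdotE; ring.
have e2 : (v + w) - (v - w) = 2 *r: w.
  by apply: rdot_inj => z; rewrite !rdotE; ring.
rewrite -e1 in h1'; rewrite -e2 in h2'.
have := dual_norm_parallelogram_le lA h3 h4 h1' h2'; lra.
Qed.

(** The orthogonal projection onto the span, by Gram-Schmidt; if v is a multiple of u, one rank-one
    projection suffices. *)
Lemma plane_effect u v : u != 0 -> exists Q, [/\ effect Q, Q u = u, Q v = v &
  forall w, Q w = w -> exists a b, w = a *: u + b *: v].
Proof.
move=> u0; pose t := dot v u * ofR '[u]^-1; pose v' := v - t *: u.
have e0 : dot v' u = 0 by apply: orthogonal_rest.
have e1 : dot u v' = 0 by rewrite dotC e0 rmorph0.
have vE : v = t *: u + v' by rewrite /v' addrC subrK.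
have fix1 x : x != 0 -> rank1 x 0 x = x.
  move=> x0; rewrite /rank1 addr0 dot_rdot -rmorphM divff ?rmorph1 ?scale1r//.
  by rewrite gt_eqF// rdot_gt0.
have [v'0|v'0] := eqVneq v' 0.
  have eu := rank1_effect u0 (lexx 0); have [lu _ _ _] := eu.
  exists (rank1 u 0); split=> //; first exact: fix1.
    by rewrite vE v'0 addr0 (semilinearZ lu) fix1.
  by move=> w <-; exists (dot w u * ofR ('[u] + 0)^-1), 0; rewrite scale0r addr0.
have eQ := diag2_effect u0 v'0 e1 (lexx 0) (lexx 0); have [lQ _ _ _] := eQ.
have Qu : diag2 u v' 0 0 u = u.
  by rewrite /diag2 fix1// /rank1 e1 mul0r scale0r addr0.
have Qv' : diag2 u v' 0 0 v' = v'.
  by rewrite /diag2 fix1// /rank1 e0 mul0r scale0r add0r.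
exists (diag2 u v' 0 0); split=> //.
  by rewrite {1}vE lQ Qu Qv' -vE.
move=> w <-; rewrite /diag2 /rank1; set a := _ * _; set b := _ * _.
exists (a - b * t), b; rewrite scalerBl -addrA; congr (_ + _).
by rewrite /v' scalerBr scalerA addrC.
Qed.

(** The parameter c survives because <Tb y, T u> is <y, u> up to the twist. *)
Lemma phi_rel_rank1 s T Ti Ta Tb u c : iso_with_adjoint s T Ti Ta Tb ->
  u != 0 -> 0 <= c -> phi_rel T Tb (rank1 u c) (rank1 (T u) c).
Proof.
move=> iT u0 c0 x; have [sP [sT _ _ _] _ K1 _ _ K4 TTa _] := iT.
have Tu0 : T u != 0.
  apply: contraNneq u0 => Tu; apply/eqP; apply: (can_inj K1).
  by rewrite Tu (semilinear0 sT).
have d1 := rank1_den u0 c0; have d2 := rank1_den Tu0 c0.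
set l := dot x u * ofR ('[u] + c)^-1.
have -> : rank1 u c x = l *: u by [].
rewrite (semilinearZ sT) /rank1 dotDl dotZl dot_rdot; congr (_ *: _).
have -> : dot (Tb (x - l *: u)) (T u) = s (l * ofR c).
  rewrite dotC (dot_radjoint sP sT TTa) K4 -(twist_conj sP) -dotC.
  congr (s _); rewrite dotBl dotZl dot_rdot.
  have -> : dot x u = l * ofR ('[u] + c).
    by rewrite /l -mulrA -rmorphM mulVf ?rmorph1 ?mulr1// gt_eqF.
  by rewrite -mulrBr -rmorphB addrC addKr.
rewrite [s (l * ofR c)]rmorphM (twist_ofR sP) -mulrDr -rmorphD -mulrA -rmorphM.
by rewrite divff ?gt_eqF// rmorph1 mulr1.
Qed.

(** * The fundamental theorem of projective geometry *)

Definition in_span2 (u v w : H) := exists a b : K, w = a *: u + b *: v.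

Lemma lin_indepP (u v : H) : u != 0 -> ~ (exists a, v = a *: u) ->
  forall a b, a *: u + b *: v = 0 -> a = 0 /\ b = 0.
Proof.
move=> u0 h a b ab; have b0 : b = 0.
  apply: contrapT => /eqP b0; apply: h; exists (- (a / b)).
  have : b^-1 *: (a *: u + b *: v) = 0 by rewrite ab scaler0.
  rewrite scalerDr !scalerA mulVf// scale1r [b^-1 * a]mulrC => /eqP.
  by rewrite addrC addr_eq0 scaleNr => /eqP.
split=> //; move: ab; rewrite b0 scale0r addr0 => /eqP.
by rewrite scaler_eq0 (negPf u0) orbF => /eqP.
Qed.

Lemma dot_inj (x y : H) : (forall z, dot x z = dot y z) -> x = y.
Proof.
move=> h; apply: rdot_inj => z.
by rewrite /rdot h.
Qed.

Ltac vec := apply: dot_inj => ?;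
  rewrite !dotE; ring.

Section FundamentalTheorem.
Variable tau : H -> H.
Hypothesis tau0 : forall u, u != 0 -> tau u != 0.
Hypothesis tau_span : forall u v w, u != 0 -> v != 0 -> w != 0 ->
  in_span2 u v w <-> in_span2 (tau u) (tau v) (tau w).
Hypothesis dim3 : forall u v : H, exists w, ~ in_span2 u v w.
Variables (e : H) (lam : H -> K).
Hypotheses (lamP : forall a x y, lam (a *: x + y) = a * lam x + lam y).
Hypothesis lam_e : lam e = 1.

Let lamD x y : lam (x + y) = lam x + lam y.
Proof. by have := lamP 1 x y; rewrite scale1r mul1r. Qed.

Let lam0 : lam 0 = 0.
Proof.
have /eqP := lamD 0 0.
by rewrite addr0 -[X in X == _]addr0 (inj_eq (addrI _)) eq_sym => /eqP.
Qed.

Let lamZ a x : lam (a *: x) = a * lam x.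
Proof. by have := lamP a x 0; rewrite lam0 !addr0. Qed.

Let e0 : e != 0.
Proof.
apply/eqP => e0; move: lam_e; rewrite e0 lam0 => /eqP.
by rewrite eq_sym oner_eq0.
Qed.

Let e' := tau e.

Let line u w : u != 0 -> w != 0 ->
  (exists a, w = a *: u) <-> (exists a, tau w = a *: tau u).
Proof.
move=> u0 w0.
have aux (x y : H) : in_span2 x x y <-> exists a, y = a *: x.
  split=> [[a [b ->]]|[a ->]]; first by exists (a + b); rewrite scalerDl.
  by exists a, 0; rewrite scale0r addr0.
by rewrite -!aux; apply: tau_span.
Qed.

Let e_w w : lam w = 0 -> e + w != 0.
Proof.
move=> w0; apply/eqP => ew; have := lamD e w.
by rewrite ew lam0 lam_e w0 addr0 => /eqP; rewrite eq_sym oner_eq0.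
Qed.

(** e + ker lam is an affine chart of the projective space, and z is the coordinate of the image of
    e + w in the chart at e'. At w = 0, where tau carries no information, z is set to 0. *)
Let S_spec w z := lam w = 0 ->
  (exists2 a, a != 0 & tau (e + w) = a *: (e' + z)) /\
  (if w == 0 then z = 0 else exists2 b, b != 0 & z = b *: tau w).

(** tau (e + w) is a combination of tau e and tau w. Both coefficients are nonzero, as e + w lies on
    neither of the lines K e and K w. *)
Let S_exists w : exists z, S_spec w z.
Proof.
have [->|w0] := eqVneq w 0.
  exists 0 => _; rewrite eqxx; split=> //; exists 1; first exact: oner_neq0.
  by rewrite scale1r !addr0.
have [lw|lw] := eqVneq (lam w) 0; last by exists 0 => lw'; rewrite lw' eqxx in lw.
have ew := e_w lw.
have /(tau_span e0 w0 ew) [a [b h]] : in_span2 e w (e + w).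
  by exists 1, 1; rewrite !scale1r.
have a0 : a != 0.
  apply/eqP => a0; have [_ []] := line w0 ew.
    by exists b; rewrite h a0 scale0r add0r.
  move=> c /(congr1 lam); rewrite lamD lamZ lw lam_e mulr0 addr0 => /eqP.
  by rewrite oner_eq0.
have b0 : b != 0.
  apply/eqP => b0; have [_ []] := line e0 ew.
    by exists a; rewrite h b0 scale0r addr0.
  move=> c ec; move/eqP: w0; apply.
  have := congr1 lam ec; rewrite lamD lamZ lw lam_e mulr1 addr0 => c1.
  by move: ec; rewrite -c1 scale1r -[X in _ = X]addr0 => /addrI.
exists ((b / a) *: tau w) => _; rewrite (negPf w0); split.
  exists a => //; rewrite h scalerDr scalerA mulrCA divff ?mulr1//.
by exists (b / a) => //; rewrite mulf_neq0 ?invr_eq0.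
Qed.

(* On ker lam, S w is the representative of the line of tau w such that
   tau (e + w) is proportional to e' + S w. *)
Theorem fundamental_theorem : exists (s : {rmorphism K -> K}) (S : H -> H),
  (forall a x y, S (a *: x + y) = s a *: S x + S y) /\
  forall u, u != 0 -> exists2 c, c != 0 & S u = c *: tau u.
Proof.
have /choice[S hS] := S_exists.
have S0 : S 0 = 0 by have [_] := hS 0 lam0; rewrite eqxx.
have S1 w : lam w = 0 -> exists2 a, a != 0 & tau (e + w) = a *: (e' + S w).
  by move=> lw; have [] := hS w lw.
have S2 w : lam w = 0 -> w != 0 -> exists2 b, b != 0 & S w = b *: tau w.
  by move=> lw w0; have [_] := hS w lw; rewrite (negPf w0).
have Sn0 w : lam w = 0 -> w != 0 -> S w != 0.
  by move=> lw w0; have [b b0 ->] := S2 w lw w0; rewrite scaler_eq0 negb_or b0 tau0.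
pose indep (u v : H) := forall a b : K, a *: u + b *: v = 0 -> a = 0 /\ b = 0.
have indepC u v : indep u v -> indep v u.
  by move=> h a b; rewrite addrC => /h[].
have indep_l u v : indep u v -> u != 0.
  move=> h; apply/eqP => u0; have [|/eqP] := h 1 0.
    by rewrite u0 scaler0 scale0r addr0.
  by rewrite oner_eq0.
have indep_r u v : indep u v -> v != 0 by move=> /indepC /indep_l.
have indepP u v : u != 0 -> ~ (exists a, v = a *: u) -> indep u v.
  exact: lin_indepP.
(* Dimension at least three leaves room in ker lam outside K u. *)
have indep_ex u : u != 0 -> lam u = 0 -> exists2 w, lam w = 0 & indep u w.
  move=> u0 lu; have [x hx] := dim3 e u; exists (x - lam x *: e).
    by rewrite addrC -scaleNr lamP lam_e mulr1 addNr.
  apply: indepP => // -[a h]; apply: hx; exists (lam x), a.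
  by rewrite -h addrC subrK.
(* A relation involving e' would place e in the span of u and v, against lam e = 1; one without it
   would make u a multiple of v, or kill S v. *)
have triple u v : lam u = 0 -> lam v = 0 -> indep u v ->
    forall a b c, a *: e' + b *: S u + c *: S v = 0 -> [/\ a = 0, b = 0 & c = 0].
  move=> lu lv uv a b c h.
  have u0 := indep_l _ _ uv; have v0 := indep_r _ _ uv.
  have [p p0 Su] := S2 u lu u0; have [q q0 Sv] := S2 v lv v0.
  have a0 : a = 0.
    apply: contrapT => /eqP a0.
    have /(tau_span u0 v0 e0) [x [y xy]] : in_span2 (tau u) (tau v) (tau e).
      exists (- (b * p) / a), (- (c * q) / a).
      have : a^-1 *: (a *: e' + b *: S u + c *: S v) = 0 by rewrite h scaler0.
      rewrite Su Sv !scalerDr !scalerA mulVf// scale1r => hh.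
      rewrite -[LHS]subr0 -hh; apply: dot_inj => z.
      by rewrite !dotE -/e'; field.
    have := congr1 lam xy; rewrite lamD !lamZ lu lv lam_e !mulr0 addr0 => /eqP.
    by rewrite oner_eq0.
  have b0 : b = 0.
    apply: contrapT => /eqP b0.
    have [_ []] := line v0 u0.
      exists (- (c * q) / (b * p)).
      have : (b * p)^-1 *: (a *: e' + b *: S u + c *: S v) = 0 by rewrite h scaler0.
      rewrite a0 Su Sv scale0r add0r => hh.
      rewrite -[LHS]subr0 -hh; apply: dot_inj => z.
      by rewrite !dotE; field; rewrite p0 b0.
    move=> x ux; have [|/eqP] := uv 1 (- x).
      by rewrite ux scale1r scaleNr subrr.
    by rewrite oner_eq0.
  split=> //; move: h; rewrite a0 b0 !scale0r !add0r => /eqP.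
  by rewrite scaler_eq0 (negPf (Sn0 v lv v0)) orbF => /eqP.
have add_indep u v : lam u = 0 -> lam v = 0 -> indep u v -> S (u + v) = S u + S v.
  move=> lu lv uv.
  have u0 := indep_l _ _ uv; have v0 := indep_r _ _ uv.
  have luv : lam (u + v) = 0 by rewrite lamD lu lv addr0.
  have uv0 : u + v != 0.
    apply/eqP => h; have [|/eqP] := uv 1 1; first by rewrite !scale1r.
    by rewrite oner_eq0.
  have [p p0 Su] := S2 u lu u0; have [q q0 Sv] := S2 v lv v0.
  have [r r0 Suv] := S2 _ luv uv0.
  have [a1 a10 h1] := S1 u lu; have [a2 a20 h2] := S1 v lv.
  have [a3 a30 h3] := S1 _ luv.
  have ew := e_w luv.
  (* The point e + u + v lies on the line through e + u and v and on the one through e + v and u.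
     Comparing the coordinates of its image in e', S u, S v with those from S (u + v) gives
     additivity. *)
  have [x1 [y1 xy1]] : in_span2 (tau (e + u)) (tau v) (tau (e + (u + v))).
    apply/(tau_span (e_w lu) v0 ew).
    by exists 1, 1; rewrite !scale1r addrA.
  have [x2 [y2 xy2]] : in_span2 (tau (e + v)) (tau u) (tau (e + (u + v))).
    apply/(tau_span (e_w lv) u0 ew).
    by exists 1, 1; rewrite !scale1r [u + v]addrC addrA.
  have [x3 [y3 xy3]] : in_span2 (tau u) (tau v) (tau (u + v)).
    by apply/(tau_span u0 v0 uv0); exists 1, 1; rewrite !scale1r.
  have tu : tau u = p^-1 *: S u by rewrite Su scalerA mulVf// scale1r.
  have tv : tau v = q^-1 *: S v by rewrite Sv scalerA mulVf// scale1r.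
  rewrite tu tv in xy1 xy2 xy3.
  rewrite h1 in xy1; rewrite h2 in xy2; rewrite xy3 in Suv.
  have [] := triple u v lu lv uv
    (x1 * a1 - x2 * a2) (x1 * a1 - y2 / p) (y1 / q - x2 * a2).
    transitivity (tau (e + (u + v)) - tau (e + (u + v))); last exact: subrr.
    by rewrite {1}xy1 xy2; vec.
  have [] := triple u v lu lv uv
    (x1 * a1 - a3) (x1 * a1 - a3 * r * x3 / p) (y1 / q - a3 * r * y3 / q).
    transitivity (tau (e + (u + v)) - tau (e + (u + v))); last exact: subrr.
    by rewrite {1}xy1 h3 Suv; vec.
  move=> /eqP; rewrite subr_eq0 => /eqP E1 /eqP; rewrite subr_eq0 => /eqP E2.
  move=> /eqP; rewrite subr_eq0 => /eqP E3 /eqP; rewrite subr_eq0 => /eqP E4.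
  move=> /eqP; rewrite subr_eq0 => /eqP E5 /eqP; rewrite subr_eq0 => /eqP E6.
  have F1 : r * x3 / p = 1.
    by apply: (mulfI a30); rewrite mulr1 !mulrA -E2.
  have F2 : r * y3 / q = 1.
    by apply: (mulfI a30); rewrite mulr1 !mulrA -E3 E6 -E4.
  transitivity ((r * x3 / p) *: S u + (r * y3 / q) *: S v).
    by rewrite Suv; vec.
  by rewrite F1 F2 !scale1r.
have indepD u v a : indep u v -> indep u (a *: u + v).
  move=> uv x y; rewrite scalerDr scalerA addrA -scalerDl => /uv[h y0].
  by move: h; rewrite y0 mul0r addr0.
have add u v : lam u = 0 -> lam v = 0 -> S (u + v) = S u + S v.
  move=> lu lv; have [->|u0] := eqVneq u 0; first by rewrite S0 !add0r.
  have [[a va]|nv] := pselect (exists a, v = a *: u); last first.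
    exact/add_indep/indepP.
  (* For v on the line of u, a third vector w off this line lets S (u + v + w) be expanded in two
     ways by the independent case. *)
  have [w lw uw] := indep_ex u u0 lu.
  have e1 : S (v + w) = S v + S w.
    have [->|v0] := eqVneq v 0; first by rewrite S0 !add0r.
    apply: add_indep => //; move=> x y.
    rewrite va scalerA => /uw[/eqP h ->]; split=> //.
    move: h; rewrite mulf_eq0 => /orP[/eqP//|/eqP a0].
    by rewrite va a0 scale0r eqxx in v0.
  have e2 : S (u + (v + w)) = S u + S (v + w).
    apply: add_indep => //; first by rewrite lamD lv lw addr0.
    by rewrite va; apply: indepD.
  have [uv0|uv0] := eqVneq (u + v) 0.
    apply: (addIr (S w)); rewrite -addrA -e1 -e2 addrA uv0 S0 !add0r//.
  apply: (addIr (S w)); rewrite -addrA -e1 -e2 addrA [RHS]add_indep//.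
    by rewrite lamD lu lv addr0.
  have uvE : u + v = (1 + a) *: u by rewrite va scalerDl scale1r.
  move=> x y; rewrite uvE scalerA => /uw[/eqP h ->]; split=> //.
  move: h; rewrite mulf_eq0 => /orP[/eqP//|/eqP a0].
  by rewrite uvE a0 scale0r eqxx in uv0.
have scal u l : lam u = 0 -> exists m, S (l *: u) = m *: S u.
  move=> lu; have [->|u0] := eqVneq u 0.
    by exists 0; rewrite scaler0 S0 scaler0.
  have [->|l0] := eqVneq l 0; first by exists 0; rewrite scale0r S0 scale0r.
  have lu0 : l *: u != 0 by rewrite scaler_eq0 negb_or l0.
  have [[c hc] _] : (exists a, tau (l *: u) = a *: tau u) /\ True.
    by split=> //; apply/(line u0 lu0); exists l.
  have [p p0 Su] := S2 u lu u0.
  have [q q0 Slu] : exists2 b, b != 0 & S (l *: u) = b *: tau (l *: u).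
    by apply: S2 => //; rewrite lamZ lu mulr0.
  by exists (q * c / p); rewrite Slu Su hc !scalerA divfK.
(* Additivity on l (u + v) forces both factors to be that of u + v. *)
have same u v l m m' : lam u = 0 -> lam v = 0 -> indep u v ->
    S (l *: u) = m *: S u -> S (l *: v) = m' *: S v -> m = m'.
  move=> lu lv uv hu hv.
  have [k hk] : exists k, S (l *: (u + v)) = k *: S (u + v).
    by apply: scal; rewrite lamD lu lv addr0.
  have [] := triple u v lu lv uv 0 (m - k) (m' - k).
    transitivity (S (l *: u + l *: v) - S (l *: (u + v))); last first.
      by rewrite scalerDr subrr.
    by rewrite add ?lamZ ?lu ?lv ?mulr0// hk add// hu hv; vec.
  by move=> _ /eqP; rewrite subr_eq0 => /eqP -> /eqP; rewrite subr_eq0 => /eqP ->.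
have [w0 lw0 w0n] : exists2 w, lam w = 0 & w != 0.
  have [x hx] := dim3 e 0; exists (x - lam x *: e).
    by rewrite addrC -scaleNr lamP lam_e mulr1 addNr.
  rewrite subr_eq0; apply/eqP => xe; apply: hx; exists (lam x), 0.
  by rewrite scaler0 addr0.
have /choice[s hs] l : exists m, S (l *: w0) = m *: S w0 by apply: scal.
have Sw0 := Sn0 w0 lw0 w0n.
have SZ u l : lam u = 0 -> S (l *: u) = s l *: S u.
  move=> lu; have [->|u0] := eqVneq u 0; first by rewrite !(scaler0, S0).
  have [m hm] := scal u l lu; rewrite hm; congr (_ *: _).
  have [[a ua]|nu] := pselect (exists a, u = a *: w0); last first.
    exact/esym/(same w0 u l)/hm/hs/indepP.
  have [w lw ww] := indep_ex w0 w0n lw0; have [k hk] := scal w l lw.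
  have uw : indep u w.
    move=> x y; rewrite ua scalerA => /ww[/eqP h ->]; split=> //.
    move: h; rewrite mulf_eq0 => /orP[/eqP//|/eqP a0].
    by rewrite ua a0 scale0r eqxx in u0.
  by rewrite (same u w l m k)// (same w0 w l (s l) k).
have s_inj x y : x *: S w0 = y *: S w0 -> x = y.
  move=> /eqP; rewrite -subr_eq0 -scalerBl scaler_eq0 (negPf Sw0) orbF subr_eq0.
  by move/eqP.
have sD x y : s (x + y) = s x + s y.
  apply: s_inj; rewrite -SZ// !scalerDl add ?lamZ ?lw0 ?mulr0//.
  by rewrite !SZ.
have sB : zmod_morphism s.
  move=> x y; apply: (addIr (s y)); by rewrite -sD !subrK.
have s1 : s 1 = 1 by apply: s_inj; rewrite -SZ// !scale1r.
have sM x y : s (x * y) = s x * s y.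
  by apply: s_inj; rewrite -SZ// -!scalerA !SZ// lamZ lw0 mulr0.
pose f : {rmorphism K -> K} := HB.pack s
  (GRing.isZmodMorphism.Build K K s sB)
  (GRing.isMonoidMorphism.Build K K s (s1, sM)).
(* The semilinear extension from ker lam that sends e to e'. *)
exists f, (fun x => s (lam x) *: e' + S (x - lam x *: e)); split=> [a x y|u u0].
  rewrite lamP /= sD sM.
  have -> : a *: x + y - (a * lam x + lam y) *: e =
      a *: (x - lam x *: e) + (y - lam y *: e) by vec.
  have lz z : lam (z - lam z *: e) = 0.
    by rewrite addrC -scaleNr lamP lam_e mulr1 addNr.
  by rewrite (add (a *: (x - lam x *: e))) ?lamZ ?lz ?mulr0// SZ ?lz//; vec.
have lz : lam (u - lam u *: e) = 0.
  by rewrite addrC -scaleNr lamP lam_e mulr1 addNr.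
set w := u - lam u *: e; have [lu0|lu0] := eqVneq (lam u) 0.
  have -> : w = u by rewrite /w lu0 scale0r subr0.
  by rewrite lu0 (raddf0 f : s 0 = 0) scale0r add0r; apply: S2.
(* The line of u meets the chart e + ker lam at u / lam u, where S is known. *)
have lw : lam ((lam u)^-1 *: w) = 0 by rewrite lamZ lz mulr0.
have [a a0 h] := S1 _ lw.
have uE : u = lam u *: (e + (lam u)^-1 *: w).
  by rewrite scalerDr scalerA divff// scale1r /w addrC subrK.
have ew := e_w lw.
have [c hc] : exists c, tau (e + (lam u)^-1 *: w) = c *: tau u.
  apply/(line u0 ew); exists (lam u)^-1; rewrite {3}uE scalerA mulVf// scale1r//.
have c0 : c != 0.
  by apply: contraNneq (tau0 ew) => c0; rewrite hc c0 scale0r.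
exists (f (lam u) * c / a); first by rewrite !mulf_neq0 ?fmorph_eq0// invr_eq0.
have -> : S w = f (lam u) *: S ((lam u)^-1 *: w).
  by rewrite -SZ// scalerA divff// scale1r.
rewrite -scalerDr.
have -> : e' + S ((lam u)^-1 *: w) = (a^-1 * c) *: tau u.
  by rewrite -scalerA -hc h scalerA mulVf// scale1r.
by rewrite !scalerA; congr (_ *: _); rewrite -!mulrA [c / a]mulrC.
Qed.

End FundamentalTheorem.

(** * Order automorphisms *)

(** A total map on functions, constrained only on effects, which avoids working in the subtype. *)
Definition order_auto (f : (H -> H) -> (H -> H)) :=
  [/\ forall A, effect A -> effect (f A),
      forall A B, effect A -> effect B -> effect_le A B <-> effect_le (f A) (f B)
    & forall B, effect B -> exists2 A, effect A & f A = B].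

Lemma effect_le_anti A B : effect A -> effect B ->
  effect_le A B -> effect_le B A -> A = B.
Proof.
move=> eA eB h1 h2; apply: effect_antisym eA eB _ => x.
by apply/le_anti/andP.
Qed.

Lemma effect0 : effect (cst 0).
Proof.
apply: effectI => [a x y|x y|x] /=; first by rewrite scaler0 addr0.
  by rewrite rdot0l rdot0r.
by rewrite !rdot0l.
Qed.

Lemma effect0_le A : effect A -> effect_le (cst 0) A.
Proof. by move=> [_ _ A0 _] x; rewrite rdot0l. Qed.

Lemma rank1_line u w a c : u != 0 -> a != 0 -> w = a *: u ->
  rank1 w c = rank1 u (c / sqn a).
Proof.
move=> u0 a0 ->; rewrite -(rank1_scale u (c / sqn a) a0).
by rewrite mulrC divfK// sqn_eq0.
Qed.

Lemma rank1_inj u c d : u != 0 -> 0 <= c -> 0 <= d ->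
  rank1 u c = rank1 u d -> c = d.
Proof.
move=> u0 c0 d0 h; apply/le_anti/andP; split.
  by apply/(rank1_le_same u0 d0 c0); rewrite h.
by apply/(rank1_le_same u0 c0 d0); rewrite h.
Qed.

(** An effect fixing u and v fixes their span; conversely, test on the projection onto that span. *)
Lemma span_charP u v w : u != 0 -> v != 0 -> w != 0 ->
  in_span2 u v w <-> (forall A, effect A -> effect_le (rank1 u 0) A ->
    effect_le (rank1 v 0) A -> effect_le (rank1 w 0) A).
Proof.
move=> u0 v0 w0; split=> [[a [b wE]] A eA|h].
  move=> /(rank1_0_leP u0 eA) Au /(rank1_0_leP v0 eA) Av.
  apply/(rank1_0_leP w0 eA); have [lA _ _ _] := eA.
  by rewrite wE lA Au (semilinearZ lA) Av.
have [Q [eQ Qu Qv Qw]] := plane_effect v u0.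
apply: Qw; apply/(rank1_0_leP w0 eQ)/h => //; exact/rank1_0_leP.
Qed.

Section OrderAuto.
Variable f : (H -> H) -> (H -> H).
Hypothesis fA : order_auto f.

Lemma auto_effect A : effect A -> effect (f A).
Proof. by case: fA => h _ _; exact: h. Qed.

Lemma auto_le A B : effect A -> effect B ->
  effect_le A B <-> effect_le (f A) (f B).
Proof. by case: fA => _ h _; exact: h. Qed.

Lemma auto_surj B : effect B -> exists2 A, effect A & f A = B.
Proof. by case: fA => _ _ h; exact: h. Qed.

Lemma auto_inj A B : effect A -> effect B -> f A = f B -> A = B.
Proof.
by move=> eA eB h; apply: effect_le_anti => //; apply/auto_le => //; rewrite h.
Qed.

Lemma auto_inverse : exists g, [/\ order_auto g,
  forall A, effect A -> g (f A) = A & forall A, effect A -> f (g A) = A].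
Proof.
have /choice[g hg] B : exists A, effect B -> effect A /\ f A = B.
  have [eB|nB] := pselect (effect B); last by exists B.
  by have [A eA h] := auto_surj eB; exists A.
have K1 A : effect A -> g (f A) = A.
  by move=> eA; have [e h] := hg _ (auto_effect eA); apply: auto_inj.
exists g; split=> // [|A eA]; last exact: (hg A eA).2.
split=> [A eA|A B eA eB|B eB]; first exact: (hg A eA).1.
  have [e1 h1] := hg _ eA; have [e2 h2] := hg _ eB.
  by rewrite (auto_le e1 e2) h1 h2.
by exists (f B); [exact: auto_effect|exact: K1].
Qed.

Lemma auto0 : f (cst 0) = cst 0.
Proof.
have [A eA h] := auto_surj effect0; rewrite -[RHS]h; congr f.
have e0 := auto_effect effect0.
apply: effect_le_anti => //; [exact: effect0|exact: effect0_le|].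
apply/auto_le => //; first exact: effect0.
by rewrite h; apply: effect0_le.
Qed.

Lemma auto_chain A : effect A -> is_chain A <-> is_chain (f A).
Proof.
move=> eA; split=> -[A0 ch]; split.
- by rewrite -auto0 => /(auto_inj eA effect0).
- move=> X Y /auto_surj[X' eX <-] /auto_surj[Y' eY <-].
  move=> /(auto_le eX eA) h1 /(auto_le eY eA) h2.
  by rewrite -(auto_le eX eY) -(auto_le eY eX); exact: ch.
- by move=> A1; apply: A0; rewrite A1 auto0.
move=> X Y eX eY; rewrite !(auto_le _ eA)// !(auto_le eX eY) (auto_le eY eX).
by apply: ch; apply: auto_effect.
Qed.

Lemma auto_rank1 u c : u != 0 -> 0 <= c ->
  exists v d, [/\ v != 0, 0 <= d & f (rank1 u c) = rank1 v d].
Proof.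
move=> u0 c0; have e := rank1_effect u0 c0.
have : is_chain (f (rank1 u c)).
  by apply/(auto_chain e)/(is_chainP e); exists u, c.
by move/(is_chainP (auto_effect e)) => [v [d [v0 d0 h]]]; exists v, d.
Qed.

Lemma auto_rank1_surj v d : v != 0 -> 0 <= d ->
  exists u c, [/\ u != 0, 0 <= c & f (rank1 u c) = rank1 v d].
Proof.
move=> v0 d0; have e := rank1_effect v0 d0.
have [A eA h] := auto_surj e.
have : is_chain A.
  by apply/(auto_chain eA); rewrite h; apply/(is_chainP e); exists v, d.
by move/(is_chainP eA) => [u [c [u0 c0 AE]]]; exists u, c; rewrite -AE.
Qed.

(** Projections are the maximal rank-one effects: the preimage of [rank1 v 0] is of rank one and
    above [rank1 u 0], hence on the line of u with parameter 0. *)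
Lemma auto_projection u : u != 0 ->
  exists2 v, v != 0 & f (rank1 u 0) = rank1 v 0.
Proof.
move=> u0; have [v [d [v0 d0 h]]] := auto_rank1 u0 (lexx 0).
have eu := rank1_effect u0 (lexx 0).
exists v => //; have [w [c [w0 c0 hw]]] := auto_rank1_surj v0 (lexx 0).
have ew := rank1_effect w0 c0.
have uw : effect_le (rank1 u 0) (rank1 w c).
  by apply/auto_le => //; rewrite h hw; apply/rank1_le_same.
have [a a0 uE] := rank1_le_rank1 u0 (lexx 0) w0 c0 uw.
rewrite -hw; congr f; move: uw; rewrite (rank1_line 0 w0 a0 uE) mul0r.
move=> /(rank1_le_same w0 (lexx 0) c0) c1.
by congr rank1; apply/le_anti; rewrite c0 c1.
Qed.

Lemma auto_lines (dim3 : forall u v : H, exists w, ~ in_span2 u v w) :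
  exists (s : {rmorphism K -> K}) (S : H -> H),
  [/\ semilin s S, forall u, u != 0 -> S u != 0 &
      forall u, u != 0 -> f (rank1 u 0) = rank1 (S u) 0].
Proof.
have /choice[tau htau] u : exists v, u != 0 -> v != 0 /\ f (rank1 u 0) = rank1 v 0.
  have [->|u0] := eqVneq u 0; first by exists 0; rewrite eqxx.
  by have [v v0 h] := auto_projection u0; exists v.
have tau0 u : u != 0 -> tau u != 0 by move=> /htau[].
have tauE u : u != 0 -> f (rank1 u 0) = rank1 (tau u) 0 by move=> /htau[].
have e1 u : u != 0 -> effect (rank1 u 0).
  by move=> u0; apply: rank1_effect.
have tau_span u v w : u != 0 -> v != 0 -> w != 0 ->
    in_span2 u v w <-> in_span2 (tau u) (tau v) (tau w).
  move=> u0 v0 w0; rewrite !span_charP ?tau0// -!tauE//; split=> h A eA.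
    have [B eB <-] := auto_surj eA.
    move=> /(auto_le (e1 _ u0) eB) h1 /(auto_le (e1 _ v0) eB) h2.
    exact/(auto_le (e1 _ w0) eB)/h.
  move=> /(auto_le (e1 _ u0) eA) h1 /(auto_le (e1 _ v0) eA) h2.
  exact/(auto_le (e1 _ w0) eA)/h/h2/h1/auto_effect.
have [e he] : exists e : H, e != 0.
  have [w hw] := dim3 0 0; exists w; apply/eqP => w0; apply: hw.
  by exists 0, 0; rewrite w0 !scaler0 addr0.
have lamP a x y : dot (a *: x + y) e * ofR '[e]^-1 =
    a * (dot x e * ofR '[e]^-1) + dot y e * ofR '[e]^-1.
  by rewrite !dotE; ring.
have lam_e : dot e e * ofR '[e]^-1 = 1.
  by rewrite dot_rdot -rmorphM divff ?rmorph1// gt_eqF// rdot_gt0.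
have [s [S [sS SE]]] := fundamental_theorem tau0 tau_span dim3 lamP lam_e.
exists s, S; split=> // u u0; have [c c0 h] := SE u u0.
  by rewrite h scaler_eq0 negb_or c0 tau0.
by rewrite tauE// (rank1_line 0 (tau0 _ u0) c0 h) mul0r.
Qed.

End OrderAuto.

(** For N = n + 1 and m the integer part of N p, both N g(p) and N p g(1) lie between m g(1) and (m
    + 1) g(1). *)
Lemma additive_monotone_linear (g : R -> R) :
  (forall p q, 0 <= p -> 0 <= q -> g (p + q) = g p + g q) ->
  (forall p q, 0 <= p -> p <= q -> g p <= g q) ->
  forall p, 0 <= p -> g p = g 1 * p.
Proof.
move=> gD g_mono p p0.
have g0 : g 0 = 0 by have := gD 0 0 (lexx _) (lexx _); rewrite addr0; lra.
have gn n q : 0 <= q -> g (n%:R * q) = n%:R * g q.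
  move=> q0; elim: n => [|n ih]; first by rewrite !mul0r g0.
  rewrite -natr1 !mulrDl !mul1r gD ?ih// mulr_ge0//.
have k0 : 0 <= g 1 by rewrite -g0; apply: g_mono.
have key n : `|g p - g 1 * p| <= g 1 / n.+1%:R.
  set N : R := n.+1%:R; have N0 : 0 < N by rewrite ltr0n.
  have Np : 0 <= N * p by rewrite mulr_ge0// ltW.
  have /andP[h1 h2] := truncn_itv Np.
  set m := Num.truncn _ in h1 h2.
  have h3 : m%:R * g 1 <= N * g p.
    by rewrite -gn// -[N * g p]gn// mulr1; apply: g_mono.
  have h4 : N * g p <= m.+1%:R * g 1.
    rewrite -gn// -[N * g p]gn// mulr1; apply: g_mono => //; exact: ltW.
  rewrite ler_pdivlMr// -[X in _ * X <= _](gtr0_norm N0) -normrM ler_norml.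
  have h5 : m%:R * g 1 <= N * p * g 1 by rewrite ler_wpM2r.
  have h6 : N * p * g 1 <= m.+1%:R * g 1 by rewrite ler_wpM2r// ltW.
  move: h4 h6; rewrite -natr1 mulrDl mul1r => h4 h6.
  by apply/andP; split; lra.
apply/eqP; rewrite -subr_eq0 -normr_eq0; apply/eqP/le_anti.
by rewrite normr_ge0 andbT; apply: le0_of_le_inv key.
Qed.

Hypothesis dimH : dim_ge 3 H.

(** Otherwise the coordinates of three independent vectors form a 3 x 2 matrix, whose left kernel
    yields a relation between them. *)
Lemma exists_not_in_span2 (u v : H) : exists w, ~ in_span2 u v w.
Proof.
apply: contrapT => h; have [w hw] := dimH.
have /choice[a ha] i : exists a : K * K, w i = a.1 *: u + a.2 *: v.
  apply: contrapT => hi; apply: h; exists (w i) => -[a [b e]].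
  by apply: hi; exists (a, b).
pose A : 'M[K]_(3, 2) := \matrix_(i, j) if j == 0 then (a i).1 else (a i).2.
have /rowV0Pn[r /sub_kermxP rA r0] : kermx A != 0.
  rewrite -mxrank_eq0 mxrank_ker subn_eq0 -ltnNge.
  exact: leq_ltn_trans (rank_leq_col A) _.
have rj j : \sum_i r 0 i * A i j = 0 by have /matrixP/(_ 0 j) := rA; rewrite !mxE.
have c0 := hw (fun i => r 0 i) _.
case/eqP: r0; apply/rowP => i; rewrite mxE; apply: c0.
under eq_bigr do rewrite ha scalerDr !scalerA.
rewrite big_split/= -!scaler_suml.
have := rj 0; have := rj 1.
under eq_bigr do rewrite mxE/=; move=> ->.
under eq_bigr do rewrite mxE/=; move=> ->.
by rewrite !scale0r addr0.
Qed.

Lemma orthogonal_exists (a u : H) : a != 0 ->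
  exists w, [/\ w != 0, dot w a = 0 & dot w u = 0].
Proof.
move=> a0; have [x hx] := exists_not_in_span2 a u.
pose pr z v := z - (dot z v * ofR '[v]^-1) *: v.
pose u' := pr u a.
have u'a : dot u' a = 0 by apply: orthogonal_rest.
have uE : u = u' + (dot u a * ofR '[a]^-1) *: a by rewrite subrK.
have [u'0|u'0] := eqVneq u' 0.
  have h : dot (pr x a) a = 0 by apply: orthogonal_rest.
  exists (pr x a); split=> //.
    apply/eqP => /eqP; rewrite subr_eq0 => /eqP e; apply: hx.
    by exists (dot x a * ofR '[a]^-1), 0; rewrite scale0r addr0.
  by rewrite uE u'0 add0r dotZr h mulr0.
set w := pr (pr x a) u'.
have wu' : dot w u' = 0 by apply: orthogonal_rest.
have wa : dot w a = 0.
  have h : dot (pr x a) a = 0 by apply: orthogonal_rest.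
  by rewrite /w /pr dotBl dotZl u'a mulr0 subr0; exact: h.
exists w; split=> //.
  apply/eqP => w0; apply: hx.
  pose t := dot x a * ofR '[a]^-1; pose t' := dot (pr x a) u' * ofR '[u']^-1.
  pose r := dot u a * ofR '[a]^-1.
  exists (t - t' * r), t'.
  have -> : x = w + t' *: u' + t *: a by rewrite /w subrK /pr subrK.
  rewrite w0; apply: dot_inj => z.
  by rewrite /u' /pr !dotE -/r; ring.
by rewrite uE dotC dotDl dotZl (dotC u') wu' (dotC a) wa !rmorph0 mulr0 addr0 rmorph0.
Qed.

(** * Action on the rank-one effects of each line *)

Section RankOneAction.
Variable f : (H -> H) -> (H -> H).
Hypothesis fA : order_auto f.
Variables (s : {rmorphism K -> K}) (S : H -> H).
Hypotheses (sS : semilin s S) (S_neq0 : forall u, u != 0 -> S u != 0).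
Hypothesis S_line : forall u, u != 0 -> f (rank1 u 0) = rank1 (S u) 0.

Let rank1_eff u c : u != 0 -> 0 <= c -> effect (rank1 u c).
Proof. exact: rank1_effect. Qed.

(** The image of [rank1 u c] lies below that of [rank1 u 0], hence on the line of S u. *)
Lemma auto_rank1_param : exists g : H -> R -> R, forall u, u != 0 ->
  [/\ forall c, 0 <= c -> 0 <= g u c /\ f (rank1 u c) = rank1 (S u) (g u c),
      forall c d, 0 <= c -> 0 <= d -> (g u c <= g u d) = (c <= d)
    & forall d, 0 <= d -> exists2 c, 0 <= c & g u c = d].
Proof.
have ex (uc : H * R) : exists d, uc.1 != 0 -> 0 <= uc.2 ->
    0 <= d /\ f (rank1 uc.1 uc.2) = rank1 (S uc.1) d.
  case: uc => u c /=.
  have [u0|u0] := eqVneq u 0; first by exists 0.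
  have [c0|c0] := leP 0 c; last by exists 0.
  have [v [d [v0 d0 h]]] := auto_rank1 fA u0 c0.
  have le1 : effect_le (rank1 v d) (rank1 (S u) 0).
    rewrite -h -S_line//.
    by apply/(auto_le fA (rank1_eff u0 c0) (rank1_eff u0 (lexx 0)))/rank1_le_same.
  have [a a0 vE] := rank1_le_rank1 v0 d0 (S_neq0 u0) (lexx 0) le1.
  exists (d / sqn a) => _ _; split; first by rewrite divr_ge0// sqn_ge0.
  by rewrite h (rank1_line d (S_neq0 u0) a0 vE).
have /choice[g hg] := ex.
exists (fun u c => g (u, c)) => u u0.
have gE c : 0 <= c -> 0 <= g (u, c) /\ f (rank1 u c) = rank1 (S u) (g (u, c)).
  by move=> c0; apply: (hg (u, c)).
have Su0 := S_neq0 u0.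
have g_le c d : 0 <= c -> 0 <= d -> (g (u, c) <= g (u, d)) = (c <= d).
  move=> c0 d0; have [gc hc] := gE c c0; have [gd hd] := gE d d0.
  apply/idP/idP => h.
    apply/(rank1_le_same u0 d0 c0).
    apply/(auto_le fA (rank1_eff u0 d0) (rank1_eff u0 c0)).
    by rewrite hc hd; apply/rank1_le_same.
  apply/(rank1_le_same Su0 gd gc); rewrite -hc -hd.
  by apply/(auto_le fA (rank1_eff u0 d0) (rank1_eff u0 c0))/rank1_le_same.
split=> // d d0; have [w [c [w0 c0 h]]] := auto_rank1_surj fA Su0 d0.
have le1 : effect_le (rank1 w c) (rank1 u 0).
  apply/(auto_le fA (rank1_eff w0 c0) (rank1_eff u0 (lexx 0))).
  by rewrite h S_line//; apply/rank1_le_same.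
have [a a0 wE] := rank1_le_rank1 w0 c0 u0 (lexx 0) le1.
have c'0 : 0 <= c / sqn a by rewrite divr_ge0// sqn_ge0.
exists (c / sqn a) => //; have [g0 h'] := gE _ c'0.
apply: (rank1_inj Su0) => //.
by rewrite -h' -h; congr f; rewrite (rank1_line c u0 a0 wE).
Qed.

Variable g : H -> R -> R.
Hypothesis gP : forall u, u != 0 ->
  [/\ forall c, 0 <= c -> 0 <= g u c /\ f (rank1 u c) = rank1 (S u) (g u c),
      forall c d, 0 <= c -> 0 <= d -> (g u c <= g u d) = (c <= d)
    & forall d, 0 <= d -> exists2 c, 0 <= c & g u c = d].

Lemma auto_param0 u : u != 0 -> g u 0 = 0.
Proof.
move=> u0; have [h1 h2 h3] := gP u0; have [c c0 gc] := h3 0 (lexx 0).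
by apply/le_anti; have := h2 0 c (lexx 0) c0; rewrite gc c0 (h1 0 _).1 => // ->.
Qed.

(** [rank1_leP] transports bounds. As [g u] is onto, any competing bound of [f A] is |S u|^2 + g u c
    for some c, and minimality is pulled back. *)
Lemma auto_dual_norm A u p : effect A -> u != 0 -> 0 <= p ->
  dual_norm A u ('[u] + p) -> dual_norm (f A) (S u) ('[S u] + g u p).
Proof.
move=> eA u0 p0 [hb hm]; have Su0 := S_neq0 u0; have [h1 h2 h3] := gP u0.
have eF := auto_effect fA eA; have [g0 gE] := h1 p p0; split.
  apply/(rank1_leP Su0 g0 eF); rewrite -gE.
  exact/(auto_le fA (rank1_eff u0 p0) eA)/(rank1_leP u0 p0 eA).
move=> m' hm'; have := dual_bound_ge eF hm'; rewrite -subr_ge0 => d0.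
have [c c0 gc] := h3 _ d0; have [gc0 gcE] := h1 c c0.
rewrite -lerBrDl -gc h2//.
have : effect_le (rank1 u c) A.
  apply/(auto_le fA (rank1_eff u0 c0) eA); rewrite gcE.
  by apply/(rank1_leP Su0 gc0 eF); rewrite gc addrC subrK.
by move/(rank1_leP u0 c0 eA)/hm; rewrite lerD2l.
Qed.

(* The parallelogram law for the dual norm of f(diag2 a b p q). *)
Lemma auto_param_orthogonal a b p q : a != 0 -> b != 0 -> dot a b = 0 ->
  0 <= p -> 0 <= q ->
  g (a + b) (p + q) + g (a - b) (p + q) = 2 * g a p + 2 * g b q.
Proof.
move=> a0 b0 ab p0 q0.
have eA := diag2_effect a0 b0 ab p0 q0.
have D := diag2_dual_norm a0 b0 ab p0 q0.
have rab : '[a, b] = 0 by rewrite /rdot ab re0.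
have pq0 : 0 <= p + q by rewrite addr_ge0.
have nab : '[a + b] = '[a] + '[b] by rewrite !rdotE (rdotC b) rab; ring.
have nab' : '[a - b] = '[a] + '[b] by rewrite !rdotE (rdotC b) rab; ring.
have ab0 : a + b != 0.
  apply/eqP => h; have := rdot_gt0 a0; have := rdot_ge0 b; move: nab.
  by rewrite h rdot0l; lra.
have ab0' : a - b != 0.
  apply/eqP => h; have := rdot_gt0 a0; have := rdot_ge0 b; move: nab'.
  by rewrite h rdot0l; lra.
have vE x y u : u = x *r: a + y *r: b ->
    dual_norm (diag2 a b p q) u (x ^+ 2 * ('[a] + p) + y ^+ 2 * ('[b] + q)).
  by move=> ->; apply: D.
have Da : dual_norm (diag2 a b p q) a ('[a] + p).
  have := vE 1 0 a; rewrite expr1n expr0n mul1r mul0r addr0; apply.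
  by apply: rdot_inj => z; rewrite !rdotE; ring.
have Db : dual_norm (diag2 a b p q) b ('[b] + q).
  have := vE 0 1 b; rewrite expr1n expr0n mul1r mul0r add0r; apply.
  by apply: rdot_inj => z; rewrite !rdotE; ring.
have Dab : dual_norm (diag2 a b p q) (a + b) ('[a + b] + (p + q)).
  have := vE 1 1 (a + b); rewrite expr1n !mul1r nab addrACA; apply.
  by apply: rdot_inj => z; rewrite !rdotE; ring.
have Dab' : dual_norm (diag2 a b p q) (a - b) ('[a - b] + (p + q)).
  have := vE 1 (-1) (a - b); rewrite sqrrN expr1n !mul1r nab' addrACA; apply.
  by apply: rdot_inj => z; rewrite !rdotE; ring.
have Fa := auto_dual_norm eA a0 p0 Da; have Fb := auto_dual_norm eA b0 q0 Db.
have Fab := auto_dual_norm eA ab0 pq0 Dab.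
have Fab' := auto_dual_norm eA ab0' pq0 Dab'.
have SB : S (a - b) = S a - S b.
  by rewrite addrC -scaleN1r sS rmorphN1 scaleN1r addrC.
have [lF _ _ _] := auto_effect fA eA.
rewrite (semilinearD sS) in Fab; rewrite SB in Fab'.
have := dual_norm_parallelogram (linear_rlinear lF) Fa Fb Fab Fab'.
by rewrite !rdotE (rdotC (S b)); lra.
Qed.

Lemma auto_param_linear : exists2 k : R, 0 < k &
  forall u c, u != 0 -> 0 <= c -> g u c = k * c.
Proof.
(* The parameters (p, 0) and (0, p) have the same left side, so g a = g b; then (p + q, 0) against
   (p, q) gives additivity. *)
have orth a b p q : a != 0 -> b != 0 -> dot a b = 0 -> 0 <= p -> 0 <= q ->
    g a p = g b p /\ g a (p + q) = g a p + g a q.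
  move=> a0 b0 ab p0 q0.
  have := auto_param_orthogonal a0 b0 ab p0 q0.
  have := auto_param_orthogonal a0 b0 ab p0 (lexx 0).
  have := auto_param_orthogonal a0 b0 ab (lexx 0) p0.
  have := auto_param_orthogonal a0 b0 ab q0 (lexx 0).
  have := auto_param_orthogonal a0 b0 ab (lexx 0) q0.
  have := auto_param_orthogonal a0 b0 ab (addr_ge0 p0 q0) (lexx 0).
  rewrite !addr0 !add0r !auto_param0//; lra.
have [a a0] : exists a : H, a != 0.
  have [w hw] := exists_not_in_span2 0 0; exists w; apply/eqP => w0; apply: hw.
  by exists 0, 0; rewrite w0 !scaler0 addr0.
have [w [w0 wa _]] := orthogonal_exists 0 a0.
have aw : dot a w = 0 by rewrite dotC wa rmorph0.
have [h1 h2 h3] := gP a0.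
exists (g a 1).
  by rewrite lt_neqAle (h1 1 ler01).1 andbT -(auto_param0 a0) eq_le !h2//
    ler01 /= -ltNge ltr01.
move=> u c u0 c0; rewrite -(additive_monotone_linear (g := g a))//.
(* A vector orthogonal to both a and u, available in dimension three, links g u to g a. *)
- have [v [v0 va vu]] := orthogonal_exists u a0.
  have [<- _] := orth v u c 0 v0 u0 vu c0 (lexx 0).
  by have [<- _] := orth v a c 0 v0 a0 va c0 (lexx 0).
- by move=> p q p0 q0; have [] := orth a w p q a0 w0 aw p0 q0.
- by move=> p q p0 pq; rewrite h2//; apply: le_trans pq.
Qed.

End RankOneAction.

(* The quadratic form of f(I/2) is finite on every line, hence coercive. *)
Lemma auto_inverse_bounded f T Ti : order_auto f ->
  T 0 = 0 -> cancel Ti T -> cancel T Ti ->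
  (forall u c, u != 0 -> 0 <= c -> f (rank1 u c) = rank1 (T u) c) -> rbounded Ti.
Proof.
move=> fA T0 K2 K1 fT.
have Ti0 v : v != 0 -> Ti v != 0.
  by move=> v0; apply: contraNneq v0 => h; rewrite -(K2 v) h T0.
set B := f half_id.
have eh := half_effect; have eB : effect B := auto_effect fA eh.
have [lB Bs B0 _] := eB; have [BD BZ] := linear_rlinear lB.
(* Thus the form of B at v is |Ti v|^2. *)
have hB u c : u != 0 -> 0 <= c -> effect_le (rank1 (T u) c) B <-> '[u] <= c.
  move=> u0 c0; rewrite -fT// -(auto_le fA)//; last exact: rank1_effect.
  exact: rank1_half.
have [//|r x|v|C C0 hC] := weakly_bounded_form (q := fun z => '[B z, z]).
- by rewrite BZ !rdotE; ring.
- have [->|v0] := eqVneq v 0; first by exists 0 => // z; rewrite rdot0l expr0n mul0r.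
  have u0 := Ti0 v v0.
  exists ('[v] + '[Ti v]); first by rewrite addr_ge0// rdot_ge0.
  have := (hB (Ti v) '[Ti v] u0 (rdot_ge0 _)).2 (lexx _).
  rewrite K2 => /(rank1_leP v0 (rdot_ge0 _) eB).
  move=> /(dual_boundP _ _ lB B0) [_ h] z.
  by apply: le_trans (h z); rewrite sqn_dotC; apply: rdot_sqr_le.
exists C => // v; have [->|v0] := eqVneq v 0.
  by rewrite -T0 K1 T0 !rdot0l mulr0.
have u0 := Ti0 v v0.
have db : dual_bound B v (C * '[v]).
  apply/(dual_boundP _ _ lB B0); split=> [|z]; first by rewrite mulr_ge0// rdot_ge0.
  apply: le_trans (dot_CauchySchwarz _ _) _.
  by rewrite mulrAC ler_wpM2r ?rdot_ge0.
have := dual_bound_ge eB db; rewrite -subr_ge0 => d0.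
have : '[Ti v] <= C * '[v] - '[v].
  apply/(hB _ _ u0 d0); rewrite K2; apply/(rank1_leP v0 d0 eB).
  by rewrite addrC subrK.
by have := rdot_ge0 v; lra.
Qed.

Lemma auto_iso f : order_auto f -> exists s T Ti Ta Tb,
  iso_with_adjoint s T Ti Ta Tb /\
  forall u c, u != 0 -> 0 <= c -> f (rank1 u c) = rank1 (T u) c.
Proof.
move=> fA; have [s [S [sS S0 S_line]]] := auto_lines fA exists_not_in_span2.
have [g gP] := auto_rank1_param fA S0 S_line.
have [k k0 gk] := auto_param_linear fA sS S0 gP.
have r0 : 0 < Num.sqrt k by rewrite sqrtr_gt0.
(* Scaling a vector by t multiplies the parameter by 1 / k, which absorbs the factor k of g. *)
pose t := ofR (Num.sqrt k)^-1.
have t0 : t != 0 by rewrite ofR_eq0 invr_eq0 gt_eqF.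
pose T u := t *: S u.
have sT : semilin s T.
  by move=> a x y; rewrite /T sS scalerDr !scalerA mulrC.
have T0 u : u != 0 -> T u != 0 by move=> u0; rewrite scaler_eq0 negb_or t0 S0.
have fT u c : u != 0 -> 0 <= c -> f (rank1 u c) = rank1 (T u) c.
  move=> u0 c0; have [h _ _] := gP u u0; have [_ ->] := h c c0.
  rewrite gk// -(rank1_scale (S u) (k * c) t0) /t sqn_ofR; congr rank1.
  by rewrite exprVn sqr_sqrtr ?ltW// mulKf// gt_eqF.
have Tz : T 0 = 0 := semilinear0 sT.
have iso_s x : sqn (s x) = sqn x.
  have [->|x0] := eqVneq x 0; first by rewrite rmorph0.
  have [u u0] : exists u : H, u != 0.
    have [w hw] := exists_not_in_span2 0 0; exists w; apply/eqP => w0; apply: hw.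
    by exists 0, 0; rewrite w0 !scaler0 addr0.
  have xu0 : x *: u != 0 by rewrite scaler_eq0 negb_or x0.
  have sx0 : s x != 0 by rewrite fmorph_eq0.
  have := fT (x *: u) (sqn x) xu0 (sqn_ge0 x).
  rewrite -[sqn x]mulr1 (rank1_scale u 1 x0) fT//.
  rewrite (semilinearZ sT) (rank1_line _ (T0 u u0) sx0 erefl) mulr1.
  move=> /rank1_inj -/(_ (T0 u u0) ler01 (divr_ge0 (sqn_ge0 _) (sqn_ge0 _))).
  by move=> /esym /divr1_eq.
have sP : id_or_conj s := isometric_rmorphism iso_s.
have T_inj u v : T u = T v -> u = v.
  move=> e; apply/eqP; rewrite -subr_eq0; apply: contraT => /T0.
  by rewrite addrC -scaleN1r sT rmorphN1 scaleN1r e addNr eqxx.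
have /choice[Ti K2] v : exists u, T u = v.
  have [->|v0] := eqVneq v 0; first by exists 0.
  have [u [c [u0 c0]]] := auto_rank1_surj fA v0 (lexx 0).
  rewrite fT// => h.
  have le1 : effect_le (rank1 v 0) (rank1 (T u) c) by rewrite h.
  have [a a0 vE] := rank1_le_rank1 v0 (lexx 0) (T0 u u0) c0 le1.
  by exists (s a *: u); rewrite (semilinearZ sT) (twistK sP).
have K1 : cancel T Ti by move=> u; apply: T_inj; rewrite K2.
have [h [hA hf fh]] := auto_inverse fA.
have Tiz : Ti 0 = 0 by rewrite -Tz K1.
have hT u c : u != 0 -> 0 <= c -> h (rank1 u c) = rank1 (Ti u) c.
  move=> u0 c0; have v0 : Ti u != 0.
    by apply: contraNneq u0 => e; rewrite -(K2 u) e Tz.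
  by rewrite -{1}(K2 u) -fT// hf//; apply: rank1_effect.
(* The inverse automorphism acts by Ti, so the bound on the inverse map is a bound on T. *)
have bT : rbounded T := auto_inverse_bounded hA Tiz K1 K2 hT.
have bij : bijective T by exists Ti.
have [Ti' [Ta [Tb iT]]] := iso_exists sP bij sT bT.
by exists s, T, Ti', Ta, Tb.
Qed.

(** * From rank-one effects to all effects, and uniqueness of T *)

Lemma phi_op_effect s T Ti Ta Tb A : iso_with_adjoint s T Ti Ta Tb ->
  effect A -> effect (phi_op dot T A).
Proof.
move=> iT eA; apply: (phi_rel_effect iT eA).
exact: (phi_op_rel iT eA).
Qed.

Lemma phi_opK s T Ti Ta Tb A : iso_with_adjoint s T Ti Ta Tb ->
  effect A -> phi_op dot Ti (phi_op dot T A) = A.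
Proof.
move=> iT eA; have eY := phi_op_effect iT eA.
have h := phi_rel_inverse iT eA (phi_op_rel iT eA).
apply: (phi_rel_unique (iso_inverse iT) eY) => //.
exact: (phi_op_rel (iso_inverse iT) eY).
Qed.

Lemma phi_op_le s T Ti Ta Tb A B : iso_with_adjoint s T Ti Ta Tb ->
  effect A -> effect B ->
  effect_le A B <-> effect_le (phi_op dot T A) (phi_op dot T B).
Proof.
have mono s' S Si Sa Sb X Y : iso_with_adjoint s' S Si Sa Sb -> effect X ->
    effect Y -> effect_le X Y -> effect_le (phi_op dot S X) (phi_op dot S Y).
  move=> iS eX eY; apply: (phi_rel_le iS eX eY).
    exact: (phi_op_rel iS eX).
  exact: (phi_op_rel iS eY).
move=> iT eA eB; split; first exact: mono iT eA eB.
move=> /(mono _ _ _ _ _ _ _ (iso_inverse iT)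
  (phi_op_effect iT eA) (phi_op_effect iT eB)).
by rewrite (phi_opK iT eA) (phi_opK iT eB).
Qed.

Lemma phi_op_rank1 s T Ti Ta Tb u c : iso_with_adjoint s T Ti Ta Tb ->
  u != 0 -> 0 <= c -> phi_op dot T (rank1 u c) = rank1 (T u) c.
Proof.
move=> iT u0 c0; have e := rank1_effect u0 c0.
apply: (phi_rel_unique iT e); first exact: (phi_op_rel iT e).
exact: (phi_rel_rank1 iT u0 c0).
Qed.

Theorem auto_phi_op f : order_auto f -> exists s T Ti Ta Tb,
  iso_with_adjoint s T Ti Ta Tb /\ forall A, effect A -> f A = phi_op dot T A.
Proof.
move=> fA; have [s [T [Ti [Ta [Tb [iT fT]]]]]] := auto_iso fA.
exists s, T, Ti, Ta, Tb; split=> // A eA.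
have [_ [sT sTi _ _] _ K1 K2 _ _ _ _] := iT.
have key u c : u != 0 -> 0 <= c -> effect_le (rank1 u c) (f A) <->
    effect_le (rank1 u c) (phi_op dot T A).
  move=> u0 c0; have v0 : Ti u != 0.
    by apply: contraNneq u0 => e; rewrite -(K2 u) e (semilinear0 sT).
  have e := rank1_effect v0 c0.
  rewrite -(K2 u) -{1}(fT _ _ v0 c0) -(auto_le fA e eA).
  by rewrite -(phi_op_rank1 iT v0 c0); apply: (phi_op_le iT).
have e1 := auto_effect fA eA; have e2 := phi_op_effect iT eA.
apply: (effect_le_anti e1 e2).
  by apply: (rank1_determined e1 e2) => u c u0 c0 /(key u c u0 c0).
by apply: (rank1_determined e2 e1) => u c u0 c0 /(key u c u0 c0).
Qed.

(** Rank-one effects give T u = a S u with |a| = 1. Evaluation at a sum of independent vectors shows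
    that they share the same a, and two arbitrary vectors are compared through a third outside their
    span. *)
Theorem phi_op_unique s T Ti Ta Tb s' S Si Sa Sb :
  iso_with_adjoint s T Ti Ta Tb -> iso_with_adjoint s' S Si Sa Sb ->
  (forall A, effect A -> phi_op dot T A = phi_op dot S A) ->
  exists c : K, `|c| = 1 /\ forall x, T x = c *: S x.
Proof.
move=> iT iS TS.
have [_ [sT _ _ _] _ K1 _ _ _ _ _] := iT.
have [sP [sS _ _ _] _ L1 _ _ _ _ _] := iS.
have T0 u : u != 0 -> T u != 0.
  by move=> u0; apply: contraNneq u0 => e; rewrite -(K1 u) e -{1}(semilinear0 sT) K1.
have S0 u : u != 0 -> S u != 0.
  by move=> u0; apply: contraNneq u0 => e; rewrite -(L1 u) e -{1}(semilinear0 sS) L1.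
have line u c : u != 0 -> 0 <= c -> rank1 (T u) c = rank1 (S u) c.
  move=> u0 c0; rewrite -(phi_op_rank1 iT)// -(phi_op_rank1 iS)//.
  by apply: TS; apply: rank1_effect.
have loc u : u != 0 -> exists2 a, sqn a = 1 & T u = a *: S u.
  move=> u0; have le1 : effect_le (rank1 (T u) 0) (rank1 (S u) 0) by rewrite line.
  have [a a0 h] := rank1_le_rank1 (T0 u u0) (lexx 0) (S0 u u0) (lexx 0) le1.
  exists a => //; have := line u 1 u0 ler01.
  rewrite (rank1_line 1 (S0 u u0) a0 h).
  move=> /rank1_inj -/(_ (S0 u u0) (divr_ge0 ler01 (sqn_ge0 a)) ler01).
  by rewrite mul1r => /(congr1 GRing.inv); rewrite invrK invr1.
have same u v a b : (forall x y : K, x *: u + y *: v = 0 -> x = 0 /\ y = 0) ->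
    T u = a *: S u -> T v = b *: S v -> a = b.
  move=> uv hu hv.
  have uv0 : u + v != 0.
    apply/eqP => h; have [|/eqP] := uv 1 1; first by rewrite !scale1r.
    by rewrite oner_eq0.
  have [c _] := loc _ uv0; rewrite (semilinearD sT) (semilinearD sS) hu hv => h.
  (* As s' is an involution, the scalars can be moved inside S, whose injectivity then gives a
     relation between u and v. *)
  have : S (s' (a - c) *: u + s' (b - c) *: v) = 0.
    rewrite sS (semilinearZ sS) !(twistK sP) !scalerBl.
    by rewrite addrACA h scalerDr -opprD subrr.
  rewrite -(semilinear0 sS) => /(can_inj L1) /uv[] /eqP.
  rewrite fmorph_eq0 subr_eq0 => /eqP -> /eqP.
  by rewrite fmorph_eq0 subr_eq0 => /eqP ->.
have [u u0] : exists u : H, u != 0.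
  have [w hw] := exists_not_in_span2 0 0; exists w; apply/eqP => w0; apply: hw.
  by exists 0, 0; rewrite w0 !scaler0 addr0.
have [c c1 hc] := loc u u0; exists c; split.
  apply/eqP; rewrite -(@eqrXn2 _ 2)// normK2 c1 rmorph1 expr1n//.
move=> x; have [->|x0] := eqVneq x 0.
  by rewrite (semilinear0 sT) (semilinear0 sS) scaler0.
have [a _ ha] := loc x x0; rewrite ha; congr (_ *: _).
have [w hw] := exists_not_in_span2 u x.
have w0 : w != 0.
  by apply/eqP => w0; apply: hw; exists 0, 0; rewrite !scale0r addr0.
have [b _ hb] := loc w w0.
have uw : ~ exists a, w = a *: u.
  by move=> [a' e]; apply: hw; exists a', 0; rewrite scale0r addr0.
have xw : ~ exists a, w = a *: x.
  by move=> [a' e]; apply: hw; exists 0, a'; rewrite scale0r add0r.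
by rewrite (same x w a b (lin_indepP x0 xw) ha hb)
  (same u w c b (lin_indepP u0 uw) hc hb).
Qed.

Theorem effect_automorphisms :
  (forall T X : H -> H,
     invertible_semilinear conj T -> effects dot X ->
     exists B : H -> H, is_inverse (phi_denom dot T X) B) /\
  (forall phi : effects dot -> effects dot,
     order_automorphism phi <->
     exists T : H -> H,
       invertible_semilinear conj T /\
       forall X : effects dot, \val (phi X) = phi_op dot T (\val X)) /\
  (forall T S : H -> H,
     invertible_semilinear conj T -> invertible_semilinear conj S ->
     (forall X : effects dot, phi_op dot T (\val X) = phi_op dot S (\val X)) ->
     exists c : K, `|c| = 1 /\ forall x : H, T x = c *: S x).
Proof.
have iso T : invertible_semilinear conj T ->
    exists s Ti Ta Tb, iso_with_adjoint s T Ti Ta Tb.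
  move/(invertible_semilinearP) => [bT [s [sP sT rT]]].
  have [Ti [Ta [Tb iT]]] := iso_exists sP bT sT rT.
  by exists s, Ti, Ta, Tb.
have valE (X : effects dot) : effect (\val X).
  by apply/(effectsP); apply: set_mem; exact: (valP X).
have opE (X Y : effects dot) :
    op_le dot (\val X) (\val Y) <-> effect_le (\val X) (\val Y).
  exact: (op_leP (valE X) (valE Y)).
have mk A : effect A -> exists X : effects dot, \val X = A.
  by move=> /(effectsP) /mem_set eA; exists (exist _ A eA).
split; [|split].
- move=> T X /iso[s [Ti [Ta [Tb iT]]]] /(effectsP) eX.
  exact: (phi_denom_inverse iT eX).
- move=> phi; split.
    move=> [[psi K1 K2] phi_le].
    (* f extends [phi] from the subtype to all maps, with arbitrary values off the effects. *)
    have /choice[f hf] A :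
        exists B, forall X : effects dot, \val X = A -> B = \val (phi X).
      have [[X XA]|nX] := pselect (exists X : effects dot, \val X = A).
        exists (\val (phi X)) => Y YA; congr (\val (phi _)); apply: val_inj.
        by rewrite XA YA.
      by exists A => X XA; case: nX; exists X.
    have fA : order_auto f.
      split=> [A /mk[X XA]|A B /mk[X XA] /mk[Y YB]|B /mk[Y YB]].
      - by rewrite (hf A X XA).
      - rewrite (hf A X XA) (hf B Y YB) -XA -YB.
        by rewrite -!opE; apply: phi_le.
      exists (\val (psi Y)) => //.
      by rewrite (hf _ (psi Y) erefl) K2.
    have [s [T [Ti [Ta [Tb [iT fT]]]]]] := auto_phi_op  fA.
    exists T; split; last first.
      by move=> X; rewrite -fT// (hf _ X erefl).
    have [sP [sT _ _ _] [bT _ _ _] L1 L2 _ _ _ _] := iT.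
    apply/(invertible_semilinearP); split; first by exists Ti.
    by exists s.
  move=> [T [/iso[s [Ti [Ta [Tb iT]]]] phiE]]; split.
    have /choice[psi hpsi] (Y : effects dot) :
        exists X : effects dot, \val X = phi_op dot Ti (\val Y).
      apply: mk; exact: (phi_op_effect (iso_inverse iT)).
    exists psi => X; apply: val_inj.
      by rewrite hpsi phiE (phi_opK iT).
    by rewrite phiE hpsi (phi_opK (iso_inverse iT)).
  move=> X Y; rewrite !opE !phiE.
  exact: (phi_op_le iT (valE X) (valE Y)).
move=> T S /iso[s [Ti [Ta [Tb iT]]]] /iso[s' [Si [Sa [Sb iS]]]] TS.
apply: (phi_op_unique  iT iS) => A /mk[X <-].
exact: TS.
Qed.

End EffectAutomorphisms.

Theorem theorem3p1 (R : realType) (k : scalar_kind)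
    (H : completeNormedModType (scalar_field R k))
    (dot : {dot H for scalar_conj R k})
    (norm_dot : forall x : H, `|x| ^+ 2 = dot x x)
    (dimH : dim_ge 3 H) :
  (* the inverse in the formula defining phi_op exists *)
  (forall T X : H -> H,
     invertible_semilinear (scalar_conj R k) T -> effects dot X ->
     exists B : H -> H, is_inverse (phi_denom dot T X) B) /\
  (forall phi : effects dot -> effects dot,
     order_automorphism phi <->
     exists T : H -> H,
       invertible_semilinear (scalar_conj R k) T /\
       forall X : effects dot, \val (phi X) = phi_op dot T (\val X)) /\
  (forall T S : H -> H,
     invertible_semilinear (scalar_conj R k) T ->
     invertible_semilinear (scalar_conj R k) S ->
     (forall X : effects dot, phi_op dot T (\val X) = phi_op dot S (\val X)) ->
     exists c : scalar_field R k,
       `|c| = 1 /\ forall x : H, T x = c *: S x).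
Proof.
case: k H dot norm_dot dimH => H dot norm_dot dimH.
  exact: (effect_automorphisms (real_scalars R) norm_dot dimH).
exact: (effect_automorphisms (complex_scalars R) norm_dot dimH).
Qed.
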